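(* Path-Contractibility can be solved by a deterministic algorithm in time $4^{k+O(\log^2 k)} + n^{O(1)}$, where $n$ is the number of vertices of the input graph.
   Context: All graphs are finite, undirected and simple. Contracting an edge $xy$ removes $x$ and $y$ and replaces them by a new vertex adjacent to exactly the vertices adjacent to at least one of $x,y$. A graph $G$ is $k$-contractible to $H$ if $H$ can be obtained from $G$ by at most $k$ edge contractions. Path-Contractibility: given a graph $G$ and an integer $k$, decide whether $G$ is $k$-contractible to a path. *)

(* Defs.v *)
From mathcomp Require Import all_boot.

Set Implicit Arguments.
Unset Strict Implicit.
Unset Printing Implicit Defensive.

Record sgraph := SGraph {
  vertex :> finType;
  edge : rel vertex;
  edge_sym : symmetric edge;
  edge_irrefl : irreflexive edge }.

Arguments edge {s}.

Definition isomorphic (G H : sgraph) : Prop :=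
  exists2 f : G -> H, bijective f & forall u v, edge (f u) (f v) = edge u v.

Section Contraction.
Variables (G : sgraph) (x y : G).

(* [Some z] is a surviving vertex [z], [None] the vertex replacing x and y. *)
Definition contract_vertex : finType :=
  option {z : G | (z != x) && (z != y)}.

Definition contract_rel (u v : contract_vertex) : bool :=
  match u, v with
  | Some a, Some b => edge (val a) (val b)
  | Some a, None => edge (val a) x || edge (val a) y
  | None, Some b => edge (val b) x || edge (val b) y
  | None, None => false
  end.

Lemma contract_sym : symmetric contract_rel.
Proof. by case=> [a|] [b|] //=; rewrite edge_sym. Qed.

Lemma contract_irrefl : irreflexive contract_rel.
Proof. by case=> [a|] //=; rewrite edge_irrefl. Qed.

Definition contract : sgraph := SGraph contract_sym contract_irrefl.

End Contraction.

Fixpoint contracts_in (j : nat) (G H : sgraph) : Prop :=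
  if j is j'.+1 then
    exists x y : G, edge x y /\ contracts_in j' (contract x y) H
  else isomorphic G H.

Definition k_contractible (k : nat) (G H : sgraph) : Prop :=
  exists2 j, j <= k & contracts_in j G H.

Section PathGraph.
Variable m : nat.

Definition path_rel (i j : 'I_m) : bool := (j == i.+1 :> nat) || (i == j.+1 :> nat).

Lemma path_rel_sym : symmetric path_rel.
Proof. by move=> i j; rewrite /path_rel orbC. Qed.

Lemma path_rel_irrefl : irreflexive path_rel.
Proof. by move=> i; rewrite /path_rel orbb ltn_eqF. Qed.

Definition path_graph : sgraph := SGraph path_rel_sym path_rel_irrefl.

End PathGraph.

(* A path has at least one vertex. *)
Definition path_contractible (G : sgraph) (k : nat) : Prop :=
  exists m : nat, k_contractible k G (path_graph m.+1).

(* Random access machines with logarithmic cost, after S. A. Cook and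
   R. A. Reckhow, Time bounded random access machines, JCSS 7 (1973), with
   natural numbers (and truncated subtraction) in place of integers. *)
Inductive instr :=
  | Const of nat & nat       (* X_i <- c *)
  | Add of nat & nat & nat   (* X_i <- X_j + X_l *)
  | Sub of nat & nat & nat   (* X_i <- X_j - X_l *)
  | Fetch of nat & nat       (* X_i <- X_(X_j) *)
  | Store of nat & nat       (* X_(X_i) <- X_j *)
  | Jump of nat & nat        (* if X_j > 0 go to instruction m, for [Jump m j] *)
  | Read of nat.             (* X_i <- next input number (0 if exhausted) *)

Definition program := seq instr.

Record config := Config {
  pc : nat;
  reg : nat -> nat;
  input : seq nat }.

Definition set_reg (r : nat -> nat) (i v : nat) : nat -> nat :=
  fun j => if j == i then v else r j.

Definition step (I : instr) (s : config) : config :=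
  let: Config p r inp := s in
  match I with
  | Const i c => Config p.+1 (set_reg r i c) inp
  | Add i j l => Config p.+1 (set_reg r i (r j + r l)) inp
  | Sub i j l => Config p.+1 (set_reg r i (r j - r l)) inp
  | Fetch i j => Config p.+1 (set_reg r i (r (r j))) inp
  | Store i j => Config p.+1 (set_reg r (r i) (r j)) inp
  | Jump m j => Config (if 0 < r j then m else p.+1) r inp
  | Read i => Config p.+1 (set_reg r i (head 0 inp)) (behead inp)
  end.

(* Number of binary digits, with bitlen 0 = 1. *)
Definition bitlen (v : nat) : nat := (trunc_log 2 v).+1.

Definition cost (I : instr) (s : config) : nat :=
  let r := reg s in
  match I with
  | Const _ _ => 1
  | Add _ j l => bitlen (r j) + bitlen (r l)
  | Sub _ j l => bitlen (r j) + bitlen (r l)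
  | Fetch _ j => bitlen (r j) + bitlen (r (r j))
  | Store i j => bitlen (r i) + bitlen (r j)
  | Jump _ j => bitlen (r j)
  | Read _ => bitlen (head 0 (input s))
  end.

(* [halts P s t s']: started in s, P halts in s' after a run of total cost t;
   P halts when the program counter leaves the program. *)
Inductive halts (P : program) : config -> nat -> config -> Prop :=
  | halts_stop s : size P <= pc s -> halts P s 0 s
  | halts_step s I t s' :
      onth P (pc s) = Some I -> halts P (step I s) t s' ->
      halts P s (cost I s + t) s'.

(* On input w, P halts in time t with answer b, read off register 0. *)
Definition answers (P : program) (w : seq nat) (t : nat) (b : bool) : Prop :=
  exists2 s, halts P (Config 0 (fun=> 0) w) t s & b = (0 < reg s 0).

(* The instance (G, k): number of vertices, k, adjacency matrix row by row. *)
Definition encode (G : sgraph) (k : nat) : seq nat :=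
  #|G| :: k :: [seq nat_of_bool (edge x y) | x <- enum G, y <- enum G].

Definition bigO (f g : nat -> nat) : Prop :=
  exists C k0, forall k, k0 <= k -> f k <= C * g k.

(* Main.v *)
Require Import Defs.
From mathcomp Require Import all_boot zify.
From Stdlib Require Import FunctionalExtensionality.

(* A graph contracts to a path with m+1 vertices by n-m-1 contractions iff its
   vertices can be labelled 0, ..., m with connected non-empty fibres (the bags)
   so that edges join equal or consecutive labels.

   Build the bags from left to right, starting from a seed vertex.  A vertex
   next to the current bag belongs to the current or to the next bag, and every
   such decision uses up one contraction, except that the first vertex of the
   next bag is free.  If only one undecided vertex touches a connected current
   bag and the next bag is still empty, putting it into the next bag is optimal.
   Otherwise one branches over three choices, each costing one contraction: the
   vertex joins the current bag; or it opens the next bag and a second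
   undecided vertex joins the current, or the next, bag.  So 3^k ternary words
   have to be tried for each seed, in time 3^k (n+k)^O(1).  As 3 < 4 this is at
   most 4^(k+O(log k)) + n^O(1), and no kernelization is needed. *)

Set Implicit Arguments.
Unset Strict Implicit.
Unset Printing Implicit Defensive.

(** * Path labellings *)

(** Soundness and completeness of the search follow different labellings. For soundness every
    undecided vertex provisionally belongs to the next bag, so labels make sense before any solution
    is known. For completeness a labelling with enough bags is given and dictates the digits; when a
    forced move contradicts it, it is replaced by one with an additional bag. Both directions keep
    the budget by comparing numbers of vertices and bags. The branching is not recursive. A word of
    choices is a number, so the machine enumerates words with a counter and replays the search from
    scratch for each, which needs no stack. To keep the machine proof manageable, the search is
    written in a small language of bounded loops, whose compiler preserves results and whose running
    time can be read off the syntax. *)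

(** Closed sets replace paths: a proof exhibits one set [A], and the notion transports along maps
    without building a path. An empty [W] counts as connected, so non-empty bags are a separate
    demand. *)
Definition connected (T : Type) (e : rel T) (W : pred T) : Prop :=
  forall A : pred T,
    (forall x y, W x -> W y -> e x y -> A x -> A y) ->
    forall x y, W x -> W y -> A x -> A y.

(** The domain [D] allows one notion for a finite graph and for the numbers below [n]. For symmetric
    [e], [label_edge] bounds the difference of labels both ways; that consecutive bags are really
    joined comes from [label_conn]. *)
Record path_labelling (T : Type) (D : pred T) (e : rel T) (h : T -> nat) (m : nat)
    : Prop := PathLabelling {
  label_le : forall x, D x -> h x <= m;
  label_surj : forall j, j <= m -> exists2 x, D x & h x = j;
  label_edge : forall x y, D x -> D y -> e x y -> h y <= (h x).+1;
  label_fibre : forall j, connected e (fun x => D x && (h x == j));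
  label_conn : connected e D }.

(** * Labellings under the contraction of one edge *)

Section ContractLift.
Variables (G : sgraph) (x y : G).
Hypothesis exy : edge x y.

(** [insub] is the quotient map: it is undefined exactly at the two ends, and [None] is the merged
    vertex. *)
Local Notation proj := (insub : G -> contract x y).

Lemma insub_end : (proj x = None) * (proj y = None).
Proof. by split; apply: insubF; rewrite eqxx ?andbF. Qed.

Lemma insub_None z : proj z = None -> z = x \/ z = y.
Proof.
case: insubP => // /negbTE; rewrite -negb_or => /negbFE /orP [] /eqP; tauto.
Qed.

Lemma contract_edge u v : edge u v -> proj u = proj v \/ contract_rel (proj u) (proj v).
Proof.
move=> euv; case Eu: (proj u) => [a|]; case Ev: (proj v) => [b|].
- right; move: Eu Ev; case: insubP => // a' _ Ea [<-]; case: insubP => // b' _ Eb [<-].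
  by rewrite /= Ea Eb.
- right; case/insub_None: Ev euv => ->; move: Eu; case: insubP => // a' _ Ea [<-] /= euv;
    by rewrite Ea euv ?orbT.
- right; case/insub_None: Eu euv => ->; move: Ev; case: insubP => // b' _ Eb [<-] /=;
    by rewrite edge_sym Eb => ->; rewrite ?orbT.
- by left.
Qed.

Lemma contract_relP (p q : contract x y) : contract_rel p q ->
  exists u v, [/\ proj u = p, proj v = q & edge u v].
Proof.
case: p q => [a|] [b|] //=.
- by exists (val a), (val b); rewrite !valK.
- case/orP=> e; [exists (val a), x | exists (val a), y]; rewrite !valK !insub_end //.
- case/orP=> e; rewrite edge_sym in e; [exists x, (val b) | exists y, (val b)];
    by rewrite !valK !insub_end.
Qed.

Lemma contract_lift (p : contract x y) : exists u, proj u = p.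
Proof. by case: p => [a|]; [exists (val a); rewrite valK | exists x; rewrite insub_end]. Qed.

(** Each fibre of [proj] is a point or the adjacent pair [x], [y], so a set closed under edges is
    constant on fibres and descends to the contracted graph as [A']. *)
Lemma connected_pull (W : pred (contract x y)) :
  connected (@edge (contract x y)) W -> connected edge (fun z => W (proj z)).
Proof.
move=> cW A clA.
pose A' (p : contract x y) := if p is Some a then A (val a) else A x.
have AA' u : W (proj u) -> A u = A' (proj u).
  case Eu: (proj u) => [a|]; first by move: Eu; case: insubP => // a' _ <- [<-].
  move=> WN; case/insub_None: Eu => -> //=.
  by apply/idP/idP; apply: clA; rewrite ?insub_end // edge_sym.
move=> u v Wu Wv; rewrite !AA' //; apply: cW => // p q Wp Wq /contract_relP.
case=> u' [v' [Ep Eq euv]]; rewrite -Ep -Eq -!AA' ?Ep ?Eq //.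
by apply: clA => //; rewrite ?Ep ?Eq.
Qed.

Lemma connected_push (W : pred (contract x y)) :
  connected edge (fun z => W (proj z)) -> connected (@edge (contract x y)) W.
Proof.
move=> cW A clA p q; case: (contract_lift p) (contract_lift q) => u <- [v <-] Wu Wv.
apply: (cW (fun z => A (proj z))) => // z w Wz Ww /contract_edge [-> //|ezw].
exact: clA.
Qed.

Lemma card_contract : #|G| = #|contract x y|.+1.
Proof.
rewrite card_option card_sig.
have nxy : y != x by apply: contraL exy => /eqP ->; rewrite edge_irrefl.
rewrite (cardD1 x) (cardD1 y) !inE nxy; congr (_ + (_ + _)).
by apply: eq_card => z; rewrite !inE andbT andbC.
Qed.

End ContractLift.

(** Pulling back along [proj] keeps [m], while each contraction accounts for one vertex; at the end
    a path is labelled by its own positions. *)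
Lemma labelling_of_contraction j (G : sgraph) m :
  contracts_in j G (path_graph m.+1) ->
  exists2 h, path_labelling xpredT (@edge G) h m & #|G| = j + m.+1.
Proof.
elim: j G => [|j IH] G /=.
  case=> f bf ef; have [g fK gK] := bf.
  have conn_path : connected (@path_rel m.+1) xpredT.
    move=> A clA.
    have A0 i (lti : i < m.+1) : A (Ordinal lti) = A ord0.
      elim: i lti => [|i IHi] lti; first by congr A; apply: val_inj.
      rewrite -(IHi (ltnW lti)).
      by apply/idP/idP; apply: clA; rewrite // /path_rel /= eqxx ?orbT.
    by move=> [u ltu] [v ltv] _ _; rewrite !A0.
  exists (fun x => nat_of_ord (f x)); last by rewrite (bij_eq_card bf) card_ord.
  split.
  - by move=> x _; rewrite -ltnS.
  - move=> i; rewrite -ltnS => lti; exists (g (Ordinal lti)) => //; by rewrite gK.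
  - move=> x y _ _; rewrite -ef /= /path_rel; lia.
  - move=> i A _ x y /eqP Ex /eqP Ey.
    suff -> : x = y by [].
    by apply: (bij_inj bf); apply: val_inj; rewrite /= Ex Ey.
  - move=> A clA x y _ _.
    rewrite -[x]fK -[y]fK; apply: (conn_path (fun i => A (g i))) => // u v _ _ euv.
    by apply: clA => //; rewrite -ef !gK.
case=> x [y [exy /IH [h [h1 h2 h3 h4 h5] card]]].
exists (fun z => h (insub z)); last by rewrite (card_contract exy) card addSn.
split.
- by move=> z _; apply: h1.
- move=> i /h2 [p _ <-]; have [u <-] := contract_lift p; by exists u.
- by move=> u v _ _ /(@contract_edge G x y) [-> //|]; apply: h3.
- move=> i; exact: (connected_pull exy (h4 i)).
- exact: (connected_pull exy h5).
Qed.

Lemma label_card (T : finType) (D : pred T) (h : T -> nat) m :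
  (forall j, j <= m -> exists2 x, D x & h x = j) -> m.+1 <= #|T|.
Proof.
move=> h2; rewrite -(size_iota 0 m.+1) cardE -(size_map h).
apply: uniq_leq_size (iota_uniq _ _) _ => j; rewrite mem_iota /= add0n ltnS => /h2 [x _ <-].
by apply: map_f; rewrite mem_enum.
Qed.

(** Two vertices with one label lie in a connected bag, so some edge inside a bag can be contracted,
    and the labels descend. Without spare vertices the labelling is a bijection, and then an
    isomorphism. *)
Lemma contraction_of_labelling j (G : sgraph) h m :
  path_labelling xpredT (@edge G) h m -> #|G| = j + m.+1 ->
  contracts_in j G (path_graph m.+1).
Proof.
elim: j G h => [|j IH] G h [h1 h2 h3 h4 h5] card /=.
  pose f x : 'I_m.+1 := inord (h x).
  have fE x : f x = h x :> nat by rewrite /f inordK // ltnS h1.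
  have inj_f : injective f.
    suff: {in predT &, injective f} by move=> inj u v; apply: inj.
    apply/image_injP; rewrite card eqn_leq -card leq_image_card card add0n.
    rewrite -{1}(card_ord m.+1); apply/subset_leq_card/subsetP=> i _.
    have [x _ Ex] : exists2 x, true & h x = i by apply: h2; rewrite -ltnS.
    apply/imageP; exists x => //; apply: val_inj; by rewrite /= fE.
  exists f; first by apply: inj_card_bij; rewrite // card_ord card.
  have hinj u v : h u = h v -> u = v.
    by move=> E; apply: inj_f; apply: val_inj; rewrite /= !fE.
  (* Were [u], [v] not adjacent, no edge could leave the set of labels at most [h u], since only
     this pair carries the labels [h u] and [h v]; this contradicts [label_conn]. *)
  have key u v : h v = (h u).+1 -> edge u v.
    move=> E; apply/idPn => nuv.
    suff: h v <= h u by rewrite E ltnn.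
    apply: (h5 (fun z => h z <= h u)) => // x y _ _ exy le_x; rewrite leqNgt.
    apply/negP=> lt_y; have le_y := h3 x y isT isT exy.
    have Ex : x = u by apply: hinj; lia.
    have Ey : y = v by apply: hinj; lia.
    by rewrite -Ex -Ey exy in nuv.
  move=> u v; rewrite /= /path_rel !fE; apply/idP/idP.
    by case/orP=> /eqP /key //; rewrite edge_sym.
  move=> euv; have := h3 u v isT isT euv; have := h3 v u isT isT; rewrite edge_sym => /(_ euv).
  have: h u <> h v by move/hinj=> E; rewrite E edge_irrefl in euv.
  lia.
have [x [y' [nxy Exy]]] : exists x y, y != x /\ h y = h x.
  suff: [exists x, exists y, (y != x) && (h y == h x)].
    by case/existsP=> x /existsP [y /andP [nxy /eqP Exy]]; exists x, y.
  apply: contraT => /existsPn no.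
  have inj_h : injective h.
    move=> u v E; apply/eqP; move: (no v) => /existsPn /(_ u).
    by rewrite E eqxx andbT negbK.
  suff: #|G| <= m.+1 by rewrite card; lia.
  rewrite cardE -(size_map h) -(size_iota 0 m.+1); apply: uniq_leq_size.
    by rewrite map_inj_uniq // enum_uniq.
  by move=> i /mapP [u _ ->]; rewrite mem_iota /= add0n ltnS h1.
have [y [exy Ey]] : exists y, edge x y /\ h y = h x.
  suff: [exists y, edge x y && (h y == h x)].
    by case/existsP=> y /andP [exy /eqP Eh]; exists y.
  apply: contraT => /existsPn no.
  (* With no neighbour of its own label, [x] alone would be a closed part of its bag, which contains
     [y'] too. *)
  suff: pred1 x y' by rewrite /= (negbTE nxy).
  apply: (h4 (h x) (pred1 x) _ x y') => //=; rewrite ?eqxx ?Exy //.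
  move=> u v _ Ev euv /eqP Eu; move: (no v).
  by rewrite -Eu euv Eu Ev.
exists x, y; split=> //.
pose h' (p : contract x y) := if p is Some a then h (val a) else h x.
have hh' z : h' (insub z) = h z.
  rewrite /h'; case E: insub => [a|].
    by move: E; case: insubP => // a' _ <- [<-].
  by case/insub_None: E => ->.
apply: (IH (contract x y) h'); last by move: card; rewrite (card_contract exy); lia.
split.
- by move=> p _; have [u <-] := contract_lift p; rewrite hh' h1.
- by move=> i /h2 [u _ <-]; exists (insub u); rewrite ?hh'.
- by move=> p q _ _ /contract_relP [u [v [<- <- euv]]]; rewrite !hh' h3.
- move=> i; apply: connected_push => A clA u v; rewrite /= !hh'; apply: (h4 i) => s t Es Et.
  by apply: clA; rewrite /= hh'.
- by apply: connected_push => A clA u v _ _; apply: h5 => // s t _ _; apply: clA.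
Qed.

(** The number of contractions is exactly [#|G| - m.+1]; [label_card] keeps this subtraction from
    being truncated. *)
Lemma path_contractibleP (G : sgraph) k :
  path_contractible G k <->
  exists h m, path_labelling xpredT (@edge G) h m /\ #|G| <= k + m.+1.
Proof.
split=> [[m [j lejk /labelling_of_contraction [h Lh card]]]|[h [m [Lh card]]]].
  by exists h, m; rewrite card leq_add2r.
have := label_card (label_surj Lh) => le_m.
exists m, (#|G| - m.+1); first by lia.
by apply: contraction_of_labelling Lh _; lia.
Qed.

(** * The branching search *)

Local Ltac iflia := repeat (case: ifP => ?); lia.

Lemma connected_ext (T : Type) (e : rel T) (W W' : pred T) :
  W =1 W' -> connected e W -> connected e W'.
Proof.
move=> E cW A clA x y; rewrite -!E; apply: cW => u v; rewrite !E; exact: clA.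
Qed.

Lemma connected_add (T : eqType) (e : rel T) (W W' : pred T) x y :
  symmetric e -> connected e W -> W x -> e x y ->
  (forall z, W' z = (z == y) || W z) -> connected e W'.
Proof.
move=> syme cW Wx exy EW A clA.
have Axy : A x = A y.
  by apply/idP/idP; apply: clA; rewrite ?EW ?Wx ?eqxx ?orbT // syme.
have AW z : W' z -> A z = A x.
  rewrite EW => /orP [/eqP -> //|Wz].
  have clW u v : W u -> W v -> e u v -> A u -> A v.
    by move=> Wu Wv; apply: clA; rewrite EW ?Wu ?Wv orbT.
  by apply/idP/idP; apply: cW.
by move=> u v Wu Wv; rewrite !AW.
Qed.

(* Statuses of vertices: 0 undecided, 1 next bag, 2 current bag, 3 current bag
   and known to be joined to its root inside the bag, 4 earlier bags.  [left] is
   the number of digits still available, [word] the number below 3 ^ left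
   whose ternary digits, most significant first, are the choices to be made. *)
Record sim := Sim { stat : nat -> nat; left : nat; word : nat; acc : bool }.

Section Search.
Variables (n : nat) (a : rel nat).
Hypothesis a_lt : forall w u, a w u -> w < n /\ u < n.
Hypothesis a_sym : symmetric a.

Local Notation vs := (iota 0 n).

Lemma in_vs w : (w \in vs) = (w < n).
Proof. by rewrite mem_iota. Qed.

Definition touches (st : nat -> nat) w := has (fun u => (st u == 3) && a w u) vs.
Definition having (st : nat -> nat) c := [seq w <- vs | st w == c].
Definition fringe (st : nat -> nat) c := [seq w <- vs | (st w == c) && touches st w].

(** Opening an empty next bag costs nothing, so there one digit also settles a second vertex [u2],
    which is what it pays for. Once the next bag is inhabited, the digits 1 and 2 act alike. *)
Definition branch st u1 (r : seq nat) d :=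
  if d == 0 then set_reg st u1 3 else
  let st1 := set_reg st u1 1 in
  if having st 1 is [::] then
    if r is u2 :: _ then set_reg st1 u2 (if d == 1 then 3 else 1) else st1
  else st1.

(** The next bag becomes current but unmarked; [y] is an arbitrary root from which the marking
    starts afresh. *)
Definition advance st y : nat -> nat :=
  set_reg (fun w => if st w == 3 then 4 else if st w == 1 then 2 else st w) y 3.

(** Stuck states are fixed points: a current bag that cannot be connected, unreachable undecided
    vertices, or a fringe left when the digits are used up. *)
Definition micro (q : sim) : sim :=
  let: Sim st l s b := q in
  match fringe st 2, fringe st 0 with
  | x :: _, _ => Sim (set_reg st x 3) l s b
  | [::], u :: r =>
      if nilp (having st 1) && nilp (having st 2) && nilp r then
        Sim (set_reg st u 1) l s b
      else if l is l'.+1 then Sim (branch st u r (s %/ 3 ^ l')) l' (s %% 3 ^ l') b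
      else q
  | [::], [::] =>
      if having st 2 is _ :: _ then q else
      if having st 1 is y :: _ then Sim (advance st y) l s b else
      if having st 0 is _ :: _ then q else Sim st l s true
  end.

Definition start v k s := Sim (set_reg (fun=> 0) v 3) k s false.
(** Statuses are numbered so that they only grow. Hence [potential], at most [4 * n], drops with
    every change, and the one additional step is the one that sets [acc]. *)
Definition accepts v k s := acc (iter (4 * n).+1 micro (start v k s)).

Lemma touchesP st w :
  reflect (exists u, [/\ u < n, st u = 3 & a w u]) (touches st w).
Proof.
apply: (iffP hasP) => [[u]|[u [ltu Eu auw]]].
  by rewrite in_vs => ltu /andP [/eqP Eu awu]; exists u.
by exists u; rewrite ?in_vs // Eu eqxx.
Qed.

Lemma fringe_nil st c : fringe st c = [::] ->
  forall w u, a w u -> st u = 3 -> st w <> c.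
Proof.
move=> E w u awu Eu Ew; have [ltw ltu] := a_lt awu.
suff: w \in fringe st c by rewrite E.
rewrite mem_filter in_vs ltw Ew eqxx andbT /=; apply/touchesP; by exists u.
Qed.

Lemma fringe_cons st c x r : fringe st c = x :: r ->
  [/\ x < n, st x = c & exists2 u, a x u & st u = 3].
Proof.
move=> E; have: x \in fringe st c by rewrite E mem_head.
rewrite mem_filter in_vs => /andP [/andP [/eqP Ex /touchesP [u [ltu Eu axu]]] ltx].
by split=> //; exists u.
Qed.

Lemma fringe_cons2 st c x y r : fringe st c = x :: y :: r ->
  [/\ y < n, y != x, st y = c & exists2 u, a y u & st u = 3].
Proof.
move=> E; have: y \in fringe st c by rewrite E !inE eqxx orbT.
have: uniq (fringe st c) by rewrite filter_uniq ?iota_uniq.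
rewrite {1}E /= inE negb_or => /andP [/andP [nxy _] _].
rewrite mem_filter in_vs => /andP [/andP [/eqP Ex /touchesP [u [ltu Eu axu]]] ltx].
by split=> //; [rewrite eq_sym | exists u].
Qed.

Lemma fringe_one st c x : fringe st c = [:: x] ->
  forall w u, a w u -> st u = 3 -> st w = c -> w = x.
Proof.
move=> E w u awu Eu Ew; have [ltw ltu] := a_lt awu.
suff: w \in fringe st c by rewrite E inE => /eqP.
rewrite mem_filter in_vs ltw Ew eqxx andbT /=; apply/touchesP; by exists u.
Qed.

Lemma having_nil st c : having st c = [::] -> forall w, w < n -> st w <> c.
Proof.
move=> E w ltw Ew; suff: w \in having st c by rewrite E.
by rewrite mem_filter in_vs ltw Ew eqxx.
Qed.

Lemma having_cons st c x r : having st c = x :: r -> x < n /\ st x = c.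
Proof.
move=> E; have: x \in having st c by rewrite E mem_head.
by rewrite mem_filter in_vs => /andP [/eqP Ex ltx].
Qed.

Lemma having_notnil st c w : w < n -> st w = c -> ~~ nilp (having st c).
Proof.
by move=> ltw Ew; apply/negP=> /nilP /having_nil /(_ w ltw).
Qed.

Lemma having_isnil st c : (forall w, w < n -> st w <> c) -> nilp (having st c).
Proof.
move=> H; case E: (having st c) => [//|x r].
by have [ltx Ex] := having_cons E; case: (H x ltx).
Qed.

Lemma micro_acc q : acc q -> acc (micro q).
Proof.
case: q => st l s b /= Eb.
case: (fringe st 2) => [|x r2] //=; case: (fringe st 0) => [|u r] /=.
  by do ![case: (having _ _) => [|? ?] //=].
by case: ifP => // _; case: l.
Qed.

Lemma iter_micro_acc f q : acc q -> acc (iter f micro q).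
Proof. by move=> H; elim: f => //= f; apply: micro_acc. Qed.

Definition undecided st := \sum_(w <- vs) (st w == 0).
Definition potential (st : nat -> nat) := \sum_(w <- vs) (4 - st w).

Lemma undecided_upd st u v : u < n -> st u = 0 -> v != 0 ->
  undecided st = (undecided (set_reg st u v)).+1.
Proof.
move=> ltu Eu nv; rewrite /undecided !(bigD1_seq u) ?in_vs ?iota_uniq //=.
rewrite Eu /set_reg !eqxx (negbTE nv) add0n add1n; congr _.+1.
by apply: eq_bigr => i /negbTE ->.
Qed.

Lemma undecided_eq st st' : (forall w, w < n -> (st w == 0) = (st' w == 0)) ->
  undecided st = undecided st'.
Proof.
by move=> H; apply: eq_big_seq => w; rewrite in_vs => /H ->.
Qed.

Lemma undecided_ge st (h : nat -> nat) b m :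
  (forall j, b < j <= m -> exists w, [/\ w < n, st w = 0 & h w = j]) ->
  m - b <= undecided st.
Proof.
move=> H.
have -> : undecided st = count (fun w => st w == 0) vs.
  by rewrite -sum1_count [RHS]big_mkcond; apply: eq_bigr => w _; case: eqP.
rewrite -size_filter.
rewrite -(size_map h) -{1}(size_iota b.+1 (m - b)).
apply: uniq_leq_size (iota_uniq _ _) _ => j; rewrite mem_iota => Hj.
have [|w [ltw Ew <-]] := H j; first by lia.
by apply: map_f; rewrite mem_filter in_vs ltw Ew.
Qed.

Lemma potential_lt st st' x : (forall w, w < n -> st w <= st' w) ->
  x < n -> st x < st' x -> st x < 4 -> potential st' < potential st.
Proof.
move=> le ltx lt1 lt4; rewrite /potential !(bigD1_seq x) ?in_vs ?iota_uniq //=.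
rewrite -addSn; apply: leq_add; first by lia.
rewrite big_seq_cond [X in _ <= X]big_seq_cond; apply: leq_sum => w.
by rewrite in_vs => /andP [/le H _]; apply: leq_sub2l.
Qed.

Lemma potential_upd st x v : x < n -> st x < v -> v <= 4 ->
  potential (set_reg st x v) < potential st.
Proof.
move=> ltx lt1 lev; apply: (@potential_lt _ _ x) => //.
- by move=> w _; rewrite /set_reg; case: eqP => [->|//]; apply: ltnW.
- by rewrite /set_reg eqxx.
- lia.
Qed.

(** * Soundness: an accepting run yields a labelling *)

Definition vertex_of w := w < n.

(* h extends the labelling of the bags built so far: unseen vertices are
   provisionally put into the next bag. *)
Record sound_inv k (st : nat -> nat) l (h : nat -> nat) i : Prop := SoundInv {
  si_max : forall w, w < n -> st w <= 4;
  si_past : forall w, w < n -> st w = 4 -> h w < i;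
  si_cur : forall w, w < n -> 2 <= st w <= 3 -> h w = i;
  si_new : forall w, w < n -> st w <= 1 -> h w = i.+1;
  si_sep : forall w u, a w u -> st w = 4 -> 2 <= st u;
  si_edge : forall w u, a w u -> h u <= (h w).+1;
  si_marked : connected a (fun w => vertex_of w && (st w == 3));
  si_bag : forall j, j < i -> connected a (fun w => vertex_of w && (h w == j));
  si_surj : forall j, j < i -> exists2 w, vertex_of w & h w = j;
  si_root : exists2 w, w < n & st w = 3;
  si_seen : connected a (fun w => vertex_of w && (0 < st w));
  si_left : l <= k;
  si_count : n + l <= k + undecided st + i.+1 + ~~ nilp (having st 1) }.

Definition solvable k := exists h m, path_labelling vertex_of a h m /\ n <= k + m.+1.

(** In [si_count], the decided vertices minus the opened bags are the contractions committed to;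
    they stay within the [k - l] digits spent. By [si_sep] the undecided [u] has no past neighbour,
    so both labels [i] and [i.+1] are compatible with its edges. *)
Lemma sound_upd k st l h i u v l' :
  sound_inv k st l h i -> u < n -> st u = 0 -> (exists2 x, a u x & st x = 3) ->
  v = 1 \/ v = 3 -> l' <= k ->
  n + l' <= k + undecided (set_reg st u v) + i.+1 +
            ~~ nilp (having (set_reg st u v) 1) ->
  exists h, sound_inv k (set_reg st u v) l' h i.
Proof.
case=> i1 i2 i3 i4 i5 i6 i7 i8 i9 i10 i11 i12 i13 ltu Eu [x aux Ex] Ev lel cnt.
have [_ ltx] := a_lt aux.
have hle w : w < n -> h w <= i.+1.
  move=> ltw; have := i1 w ltw; have := i2 w ltw; have := i3 w ltw; have := i4 w ltw; lia.
have nx : x != u by apply/eqP=> E; rewrite E Eu in Ex.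
(* Status 1 confirms the provisional label [i.+1]; status 3 lowers it to [i]. *)
pose h' w := if (v == 3) && (w == u) then i else h w.
have h'u : h' u = if v == 3 then i else i.+1.
  by rewrite /h' eqxx andbT (i4 u) ?Eu.
have h'n w : w != u -> h' w = h w by rewrite /h' => /negbTE ->; rewrite andbF.
have stu : set_reg st u v u = v by rewrite /set_reg eqxx.
have stn w : w != u -> set_reg st u v w = st w by rewrite /set_reg => /negbTE ->.
exists h'; split=> //.
- by move=> w ltw; rewrite /set_reg; case: eqP => _; [lia | apply: i1].
- move=> w ltw; case: (eqVneq w u) => [->|nw]; first by rewrite stu; iflia.
  by rewrite stn // h'n //; apply: i2.
- move=> w ltw; case: (eqVneq w u) => [->|nw]; first by rewrite stu h'u; iflia.
  by rewrite stn // h'n //; apply: i3.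
- move=> w ltw; case: (eqVneq w u) => [->|nw]; first by rewrite stu h'u; iflia.
  by rewrite stn // h'n //; apply: i4.
- move=> w z awz; case: (eqVneq w u) => [->|nw]; first by rewrite stu; iflia.
  rewrite stn // => E4; have := i5 w z awz E4; case: (eqVneq z u) => [->|nz]; first by rewrite Eu.
  by rewrite stn.
- move=> w z awz; have [ltw ltz] := a_lt awz.
  case: (eqVneq z u) => [Ez|nz]; case: (eqVneq w u) => [Ew|nw].
  + by rewrite Ez Ew.
  + rewrite Ez h'u h'n //; have := i1 w ltw; have := i3 w ltw; have := i4 w ltw.
    by have := i5 w z awz; rewrite Ez Eu; iflia.
  + by rewrite Ew h'u h'n //; have := hle z ltz; iflia.
  + by rewrite !h'n // i6.
- case: Ev => Ev.
    apply: connected_ext i7 => w; case: (eqVneq w u) => [->|nw]; last by rewrite stn.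
    by rewrite stu Eu Ev.
  apply: (connected_add (y := u) (x := x)) i7 _ _ _; rewrite ?(a_sym x) //.
    by rewrite /vertex_of ltx Ex.
  move=> z; case: (eqVneq z u) => [->|nw]; last by rewrite stn.
  by rewrite stu Ev /vertex_of ltu.
- move=> j ltj; apply: connected_ext (i8 j ltj) => w.
  case: (eqVneq w u) => [->|nw]; last by rewrite h'n.
  by rewrite h'u (i4 u) ?Eu //; congr (_ && _); iflia.
- move=> j ltj; have [w ltw Ew] := i9 j ltj; exists w => //.
  rewrite h'n //; apply/eqP=> Ewu; by move: Ew; rewrite Ewu i4 ?Eu //; iflia.
- by exists x => //; rewrite stn.
- apply: (connected_add (y := u) (x := x)) i11 _ _ _; rewrite ?(a_sym x) //.
    by rewrite /vertex_of ltx Ex.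
  move=> z; case: (eqVneq z u) => [->|nw]; last by rewrite stn.
  by rewrite stu /vertex_of ltu; iflia.
Qed.

Lemma having_upd_same st u v c : u < n -> v = c -> ~~ nilp (having (set_reg st u v) c).
Proof. by move=> ltu Ev; apply: (having_notnil ltu); rewrite /set_reg eqxx. Qed.

Lemma having_upd_keep st u v c : u < n -> st u <> c -> ~~ nilp (having st c) ->
  ~~ nilp (having (set_reg st u v) c).
Proof.
move=> ltu nu; case E: (having st c) => [//|y r] _; have [lty Ey] := having_cons E.
apply: (having_notnil lty); rewrite /set_reg; case: eqP => // Eyu; by rewrite -Eyu in nu.
Qed.

Lemma sound_step k q : 
  (acc q -> solvable k) -> (exists h i, sound_inv k (stat q) (left q) h i) ->
  (acc (micro q) -> solvable k) /\
  exists h i, sound_inv k (stat (micro q)) (left (micro q)) h i.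
Proof.
case: q => st l s b /= Hb [h [i I]].
have [i1 i2 i3 i4 i5 i6 i7 i8 i9 i10 i11 i12 i13] := I.
case E2: (fringe st 2) => [|x r2] /=; last first.
  have [ltx Ex [u axu Eu]] := fringe_cons E2; have [_ ltu] := a_lt axu.
  have nux : u != x by apply/eqP=> E; rewrite E Ex in Eu.
  split=> //; exists h, i; split=> //.
  - by move=> w ltw; rewrite /set_reg; case: (w =P x) => // _; apply: i1.
  - by move=> w ltw; rewrite /set_reg; case: (w =P x) => // _; apply: i2.
  - move=> w ltw; rewrite /set_reg; case: (w =P x) => [->|_]; last exact: i3.
    by move=> _; apply: i3; rewrite ?Ex.
  - by move=> w ltw; rewrite /set_reg; case: (w =P x) => // _; apply: i4.
  - move=> w z awz; rewrite /set_reg; case: (w =P x) => // _ E4.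
    by case: (z =P x) => // _; apply: i5 awz E4.
  - apply: (connected_add (y := x) (x := u)) i7 _ _ _; rewrite ?(a_sym u) //.
      by rewrite /vertex_of ltu Eu.
    by move=> z; rewrite /set_reg /vertex_of; case: (z =P x) => [->|//]; rewrite ltx.
  - by exists u => //; rewrite /set_reg (negbTE nux).
  - apply: connected_ext i11 => w; rewrite /set_reg; case: (w =P x) => [->|//].
    by rewrite Ex.
  - rewrite (undecided_eq (st' := st)); last first.
      by move=> w ltw; rewrite /set_reg; case: (w =P x) => [->|//]; rewrite Ex.
    move: i13; case: (boolP (nilp (having st 1))) => //= [_|nn1]; first by iflia.
    by rewrite (having_upd_keep _ ltx _ nn1) // Ex.
case E0: (fringe st 0) => [|u r] /=; last first.
  have [ltu Eu [x aux Ex]] := fringe_cons E0; have [_ ltx] := a_lt aux.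
  case: ifP => [/andP [/andP [n1 n2] nr]|nforced] /=.
    split=> //.
    have [h' Ih'] : exists h', sound_inv k (set_reg st u 1) l h' i; last by exists h', i.
    apply: (sound_upd I ltu Eu (ex_intro2 _ _ x aux Ex)); [by left | by [] |].
    rewrite having_upd_same // ; move: i13; rewrite n1 (@undecided_upd st u 1) //; iflia.
  case: l I i12 i13 => [|l] I i12 i13 //=; first by split=> //; exists h, i.
  split=> //; rewrite /branch.
  have updE w v z : z != w -> set_reg st w v z = st z by rewrite /set_reg => /negbTE ->.
  have fin v : v = 1 \/ v = 3 ->
      ~~ nilp (having st 1) || (v == 3) || nilp r -> exists h' i', sound_inv k (set_reg st u v) l h' i'.
    move=> Ev side.
    have [h' Ih'] : exists h', sound_inv k (set_reg st u v) l h' i; last by exists h', i.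
    apply: (sound_upd I ltu Eu (ex_intro2 _ _ x aux Ex)) => //; first by lia.
    move: i13; rewrite (@undecided_upd st u v) //; last by iflia.
    case: (boolP (nilp (having st 1))) => [n1|n1]; first by iflia.
    by rewrite (having_upd_keep _ ltu _ n1) ?Eu //; iflia.
  case: ifP => _; first by apply: fin; [right | rewrite orbT].
  case E1: (having st 1) => [|y r1]; last by apply: fin; [left | rewrite E1].
  case Er: r => [|u2 r2]; first by apply: fin; [left | rewrite Er orbT].
  rewrite Er in E0; have [ltu2 nu2 Eu2 [x2 aux2 Ex2]] := fringe_cons2 E0.
  have [_ ltx2] := a_lt aux2.
  have nx2 : x2 != u by apply/eqP=> E; rewrite E Eu in Ex2.
  (* Opening the next bag gains a bag together with a vertex, so all [l.+1] digits are still there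
     for the decision on [u2]. *)
  have [h' Ih'] : exists h', sound_inv k (set_reg st u 1) l.+1 h' i.
    apply: (sound_upd I ltu Eu (ex_intro2 _ _ x aux Ex)); [by left | by [] |].
    rewrite having_upd_same //; move: i13; rewrite E1 (@undecided_upd st u 1) //=; iflia.
  have Eu2' : set_reg st u 1 u2 = 0 by rewrite updE.
  have Ex2' : set_reg st u 1 x2 = 3 by rewrite updE.
  set v := if s %/ 3 ^ l == 1 then 3 else 1.
  have Ev : v = 1 \/ v = 3 by rewrite /v; case: ifP; [right | left].
  have [h'' Ih''] : exists h', sound_inv k (set_reg (set_reg st u 1) u2 v) l h' i; last by exists h'', i.
  apply: (sound_upd Ih' ltu2 Eu2' (ex_intro2 _ _ x2 aux2 Ex2')) => //; first by lia.
  have := si_count Ih'.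
  rewrite (@undecided_upd _ u2 v) //; last by lia.
  rewrite (having_upd_same st ltu (erefl 1)).
  by rewrite (having_upd_keep _ ltu2 _ (having_upd_same st ltu (erefl 1))) ?Eu2' //; lia.
case H2: (having st 2) => [|? ?] /=; last by split=> //; exists h, i.
have no2 := having_nil H2; have nf2 := fringe_nil E2; have nf0 := fringe_nil E0.
(* No status 2 is left, so the marked vertices are all of bag [i], and [si_marked] becomes the
   connectivity of a finished bag. *)
have bagE j : j = i -> forall w, vertex_of w && (st w == 3) = vertex_of w && (h w == j).
  move=> -> w; rewrite /vertex_of; case: (ltnP w n) => // ltw /=.
  have := i1 w ltw; have := i2 w ltw; have := i3 w ltw; have := i4 w ltw; have := no2 w ltw; iflia.
case H1: (having st 1) => [|y r1] /=; last first.
  have [lty Ey] := having_cons H1.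
  (* Unseen vertices move on to the new next bag [i.+2]. The fringe is empty, so none of them is
     adjacent to a marked vertex and no edge skips a label. *)
  split=> //; exists (fun w => if st w == 0 then i.+2 else h w), i.+1.
  have advE w : w < n -> advance st y w = if w == y then 3 else if st w == 3 then 4
            else if st w == 1 then 2 else st w by [].
  split=> //.
  - by move=> w ltw; rewrite advE //; have := i1 w ltw; iflia.
  - move=> w ltw; rewrite advE //.
    have := i2 w ltw; have := i3 w ltw; iflia.
  - move=> w ltw; rewrite advE //; case: (w =P y) => [->|_].
      by rewrite Ey i4 ?Ey.
    have := i4 w ltw; have := no2 w ltw; iflia.
  - move=> w ltw; rewrite advE //; case: (w =P y) => [->|_ E]; first by iflia.
    by case: eqP => //; move: E; iflia.
  - move=> w u awu; have [ltw ltu] := a_lt awu; rewrite !advE //.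
    have := i5 w u awu; have := no2 w ltw; have := i1 u ltu.
    rewrite a_sym in awu; have := nf0 u w awu; iflia.
  - move=> w u awu; have [ltw ltu] := a_lt awu.
    have := i6 w u awu; have := i5 w u awu.
    have hle : h u <= i.+1.
      have := i1 u ltu; have := i2 u ltu; have := i3 u ltu; have := i4 u ltu; iflia.
    have := i1 w ltw; have := no2 w ltw; have := i4 w ltw.
    rewrite a_sym in awu; have := nf0 u w awu; iflia.
  - move=> A clA w u; rewrite /advance /set_reg.
    have only z : vertex_of z && ((if z == y then 3 else if st z == 3 then 4 else
        if st z == 1 then 2 else st z) == 3) -> z = y by case: eqP => //; iflia.
    by move=> /only -> /only ->.
  - move=> j; rewrite ltnS leq_eqVlt => /orP [/eqP Ej|ltj].
      apply: connected_ext i7 => w; rewrite (bagE _ Ej) /vertex_of.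
      case: (ltnP w n) => //= ltw; have := i4 w ltw; iflia.
    apply: connected_ext (i8 j ltj) => w; rewrite /vertex_of.
    case: (ltnP w n) => //= ltw; have := i4 w ltw; iflia.
  - move=> j; rewrite ltnS leq_eqVlt => /orP [/eqP ->|ltj].
      by have [w ltw Ew] := i10; exists w => //; rewrite Ew i3 ?Ew.
    have [w ltw Ew] := i9 j ltj; exists w => //; have := i4 w ltw; iflia.
  - by exists y => //; rewrite advE ?eqxx.
  - apply: connected_ext i11 => w; rewrite /vertex_of; case: (ltnP w n) => //= ltw.
    by rewrite advE //; case: (w =P y) => [->|]; rewrite ?Ey //; iflia.
  - rewrite (@undecided_eq (advance st y) st); first by move: i13; rewrite H1 /=; iflia.
    by move=> w ltw; rewrite advE //; case: (w =P y) => [->|]; rewrite ?Ey //; iflia.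
case H0: (having st 0) => [|? ?] /=; last by split=> //; exists h, i.
split; last by exists h, i.
(* Nothing is undecided or waiting, so [h] is no longer provisional and bag [i] is the last one. *)
move=> _; exists h, i.
have no1 := having_nil H1; have no0 := having_nil H0.
split; last first.
  suff U0 : undecided st = 0 by move: i13; rewrite U0 H1 /=; iflia.
  by rewrite /undecided big1_seq // => w /= ; rewrite in_vs => /no0 /eqP /negbTE ->.
have stE w : w < n -> st w = 3 \/ st w = 4.
  move=> ltw; have := i1 w ltw; have := no0 w ltw; have := no1 w ltw; have := no2 w ltw; iflia.
split.
- move=> w ltw; have := stE w ltw; have := i2 w ltw; have := i3 w ltw; iflia.
- move=> j; rewrite leq_eqVlt => /orP [/eqP ->|]; last exact: i9.
  by have [w ltw Ew] := i10; exists w => //; rewrite i3 ?Ew.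
- by move=> w u _ _; apply: i6.
- move=> j; case: (ltngtP j i) => [|gtj|Ej]; first exact: i8.
    move=> A _ w u /andP [ltw /eqP Ew].
    have := stE w ltw; have := i2 w ltw; have := i3 w ltw; iflia.
  by apply: connected_ext i7; apply: bagE.
- apply: connected_ext i11 => w; rewrite /vertex_of; case: (ltnP w n) => //= /stE; iflia.
Qed.

Lemma accepts_sound v k s : v < n -> accepts v k s -> solvable k.
Proof.
move=> ltv; rewrite /accepts.
set f := (4 * n).+1.
suff [] : (acc (iter f micro (start v k s)) -> solvable k) /\
  exists h i, sound_inv k (stat (iter f micro (start v k s)))
                          (left (iter f micro (start v k s))) h i by [].
elim: f => [|f [IH1 IH2]]; last exact: sound_step.
split=> //=; exists (fun w => w != v : nat), 0.
have stE w : set_reg (fun=> 0) v 3 w = if w == v then 3 else 0 by [].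
have sing (P : pred nat) : (forall w, P w -> w = v) -> connected a P.
  by move=> HP A _ w u /HP -> /HP ->.
split=> //.
- by move=> w _; rewrite stE; case: (w =P v).
- by move=> w _; rewrite stE; case: (w =P v).
- by move=> w _; rewrite stE; case: (w =P v).
- by move=> w _; rewrite stE; case: (w =P v).
- by move=> w u _; rewrite stE; case: (w =P v).
- by move=> w u _; case: (_ != _) (_ != _) => [] [].
- by apply: sing => w; rewrite stE; case: (w =P v) => //; rewrite andbF.
- by exists v; rewrite ?stE ?eqxx.
- by apply: sing => w; rewrite stE; case: (w =P v) => //; rewrite andbF.
- have := @undecided_upd (fun=> 0) v 3 ltv erefl erefl.
  rewrite {1}/undecided /= sum1_size size_iota; iflia.
Qed.

(** * Completeness: a labelling guides some word to acceptance *)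

(** Here [h] is a full solution with which the statuses agree. Of the undecided vertices, [m - i],
    or one less if the next bag is inhabited, will open bags for free; [ci_count] says that the [l]
    digits pay for the others. *)
Record complete_inv (st : nat -> nat) l (h : nat -> nat) m i : Prop := CompleteInv {
  ci_lab : path_labelling vertex_of a h m;
  ci_max : forall w, w < n -> st w <= 4;
  ci_past : forall w, w < n -> (st w == 4) = (h w < i);
  ci_cur : forall w, w < n -> 2 <= st w <= 3 -> h w = i;
  ci_next : forall w, w < n -> st w = 1 -> h w = i.+1;
  ci_sep : forall w u, a w u -> st w = 4 -> 2 <= st u;
  ci_root : exists2 w, w < n & st w = 3;
  ci_count : undecided st + i + ~~ nilp (having st 1) <= l + m }.

Lemma complete_upd st l h m i u v l' :
  complete_inv st l h m i -> u < n -> st u = 0 ->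
  v = 1 /\ h u = i.+1 \/ v = 3 /\ h u = i ->
  undecided (set_reg st u v) + i + ~~ nilp (having (set_reg st u v) 1) <= l' + m ->
  complete_inv (set_reg st u v) l' h m i.
Proof.
case=> c0 c1 c2 c3 c4 c5 [x ltx Ex] c8 ltu Eu Ev cnt.
have stu : set_reg st u v u = v by rewrite /set_reg eqxx.
have stn w : w != u -> set_reg st u v w = st w by rewrite /set_reg => /negbTE ->.
split=> //.
- by move=> w ltw; rewrite /set_reg; case: (w =P u) => _; [lia | apply: c1].
- by move=> w ltw; case: (eqVneq w u) => [->|nw]; [rewrite stu; lia | rewrite stn // c2].
- by move=> w ltw; case: (eqVneq w u) => [->|nw]; [rewrite stu; lia | rewrite stn //; apply: c3].
- by move=> w ltw; case: (eqVneq w u) => [->|nw]; [rewrite stu; lia | rewrite stn //; apply: c4].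
- move=> w z awz; case: (eqVneq w u) => [->|nw]; first by rewrite stu; lia.
  rewrite stn // => E4; have := c5 w z awz E4; case: (eqVneq z u) => [->|nz]; first by rewrite Eu.
  by rewrite stn.
- by exists x => //; rewrite stn //; apply/eqP=> E; rewrite -E Ex in Eu.
Qed.

(* If the marked part M of the current bag is connected, has a single undecided
   neighbour u and no other neighbour outside the past, then cutting any bag
   containing M and u into M and the rest again gives a labelling, with one
   more bag. *)
Lemma labelling_split st l h m i u :
  complete_inv st l h m i -> connected a (fun w => vertex_of w && (st w == 3)) ->
  fringe st 2 = [::] -> fringe st 0 = [:: u] ->
  having st 1 = [::] -> having st 2 = [::] -> h u = i ->
  path_labelling vertex_of a
    (fun w => if (st w == 3) || (h w < i) then h w else (h w).+1) m.+1.
Proof.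
move=> [[h1 h2 h3 h4 h5] c1 c2 c3 c4 c5 [x ltx Ex] c8] cM E2 E0 H1 H2 hu.
have no1 := having_nil H1; have no2 := having_nil H2; have nf := fringe_one E0.
have [ltu Eu [x' aux' Ex']] := fringe_cons E0; have [_ ltx'] := a_lt aux'.
set h' := fun w => _.
have h'3 w : w < n -> st w = 3 -> h' w = i.
  by move=> ltw Ew; rewrite /h' Ew /= (c3 w) // Ew.
have h'4 w : w < n -> st w = 4 -> h' w = h w /\ h w < i.
  by move=> ltw Ew; rewrite /h' -(c2 w ltw) Ew.
have h'0 w : w < n -> st w = 0 -> h' w = (h w).+1 /\ i <= h w.
  by move=> ltw Ew; rewrite /h' -(c2 w ltw) Ew /= leqNgt -(c2 w ltw) Ew.
have stE w : w < n -> [\/ st w = 0, st w = 3 | st w = 4].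
  move=> ltw; have := c1 w ltw; have := no1 w ltw; have := no2 w ltw.
  case: (st w) => [|[|[|[|[|?]]]]] //; by [constructor 1 | constructor 2 | constructor 3].
have M_nbr w z : a w z -> st w = 3 -> st z = 0 -> z = u.
  by move=> awz Ew Ez; apply: (nf z w) => //; rewrite a_sym.
split.
- by move=> w /h1; rewrite /h'; case: ifP => _; lia.
- move=> j lej; case: (ltngtP j i) => [ltj|gtj|->].
  + have [|w ltw Ew] := h2 j; first by have := h1 x ltx; rewrite (c3 x) ?Ex //; lia.
    by exists w => //; rewrite /h' Ew ltj orbT.
  + case: (eqVneq j i.+1) => [->|nj].
      by exists u => //; have [-> _] := h'0 u ltu Eu; rewrite hu.
    have [|w ltw Ew] := h2 j.-1; first by lia.
    exists w => //; have := c3 w ltw; rewrite /h'; case: (st w =P 3) => [->|_] /=; first by lia.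
    by case: ifP; lia.
  + by exists x => //; apply: h'3.
- move=> w z ltw ltz awz; have := h3 w z ltw ltz awz.
  case: (stE w ltw) => Ew; case: (stE z ltz) => Ez.
  + have [-> _] := h'0 w ltw Ew; have [-> _] := h'0 z ltz Ez; lia.
  + have [-> ?] := h'0 w ltw Ew; rewrite (h'3 z) //; lia.
  + have [-> ?] := h'0 w ltw Ew; have [-> ?] := h'4 z ltz Ez; lia.
  + rewrite (h'3 w) // => _; rewrite (M_nbr w z awz Ew Ez).
    by have [-> _] := h'0 u ltu Eu; rewrite hu.
  + by rewrite !h'3.
  + by rewrite (h'3 w) // => _; have [-> ?] := h'4 z ltz Ez; lia.
  + by have := c5 w z awz Ew; rewrite Ez.
  + by have [-> ?] := h'4 w ltw Ew; rewrite (h'3 z) // (c3 z) // Ez.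
  + by have [-> ?] := h'4 w ltw Ew; have [-> ?] := h'4 z ltz Ez.
- move=> j; case: (ltngtP j i) => [ltj|gtj|->].
  + apply: connected_ext (h4 j) => w; rewrite /vertex_of; case: (ltnP w n) => //= ltw.
    case: (stE w ltw) => Ew.
    * by have [-> ?] := h'0 w ltw Ew; lia.
    * by rewrite (h'3 w) // (c3 w) // Ew.
    * by have [-> ?] := h'4 w ltw Ew.
  + case: (eqVneq j i.+1) => [->|nj]; last first.
      apply: connected_ext (h4 j.-1) => w; rewrite /vertex_of; case: (ltnP w n) => //= ltw.
      case: (stE w ltw) => Ew.
      * by have [-> ?] := h'0 w ltw Ew; lia.
      * by rewrite (h'3 w) // (c3 w) ?Ew //; lia.
      * by have [-> ?] := h'4 w ltw Ew; lia.
    have bagE w : w < n -> (h' w == i.+1) = (h w == i) && (st w == 0).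
      move=> ltw; case: (stE w ltw) => Ew; rewrite Ew ?andbT ?andbF.
      * by have [-> ?] := h'0 w ltw Ew; lia.
      * by rewrite (h'3 w) //; lia.
      * by have [-> ?] := h'4 w ltw Ew; lia.
    (* A closed subset [A] of the remainder that contains [u] fills it: together with the marked
       part it is closed in the old connected bag, because [u] is the only undecided vertex next to
       a marked one. *)
    have bagu (A : pred nat) :
        (forall w z, vertex_of w && (h' w == i.+1) -> vertex_of z && (h' z == i.+1) ->
           a w z -> A w -> A z) ->
        A u -> forall z, z < n -> h z = i -> st z = 0 -> A z.
      move=> clA Au z ltz hz Ez.
      suff: (st z == 3) || A z by rewrite Ez.
      pose A' w := (st w == 3) || A w.
      apply: (h4 i A' _ x z); rewrite /A' /vertex_of ?ltx ?ltz ?hz ?(c3 x) ?Ex ?eqxx //.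
      move=> w y /andP [ltw hw] /andP [lty hy] awy.
      case: (stE y lty) => Ey; rewrite ?Ey //=; last first.
        by move: (c2 y lty); rewrite Ey (eqP hy) ltnn.
      case: (stE w ltw) => Ew; rewrite Ew //=; last first.
      * by move: (c2 w ltw); rewrite Ew (eqP hw) ltnn.
      * by rewrite (M_nbr w y awy Ew Ey).
      * by apply: clA; rewrite /vertex_of ?ltw ?lty ?bagE // ?hw ?hy ?Ew ?Ey.
    move=> A clA w z /andP [ltw]; rewrite bagE // => /andP [/eqP hw /eqP Ew].
    move=> /andP [ltz]; rewrite bagE // => /andP [/eqP hz /eqP Ez] Aw.
    (* If [A] missed [u], its complement, closed as well, would contain [u] and hence [w]. *)
    apply: (bagu A clA) => //; apply: contraT => nAu.
    suff: ~~ A w by rewrite Aw.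
    apply: (bagu (fun y => ~~ A y)) => // y y' Hy Hy' ayy'; apply: contra.
    by apply: clA; rewrite // a_sym.
  + apply: connected_ext cM => w; rewrite /vertex_of; case: (ltnP w n) => //= ltw.
    case: (stE w ltw) => Ew; rewrite Ew.
    * by have [-> ?] := h'0 w ltw Ew; lia.
    * by rewrite (h'3 w) // !eqxx.
    * by have [-> ?] := h'4 w ltw Ew; lia.
- exact: h5.
Qed.

(* Every bag beyond the current and next one still needs an undecided vertex;
   u is one undecided vertex too many, so the budget is not exhausted. *)
Lemma complete_budget st l h m i u :
  complete_inv st l h m i -> u < n -> st u = 0 ->
  (forall j, i + ~~ nilp (having st 1) < j <= m ->
     exists w, [/\ w < n, w != u, st w = 0 & h w = j]) ->
  0 < l.
Proof.
move=> I ltu Eu reps; have := ci_count I.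
have [x ltx Ex] := ci_root I.
have lei : i <= m by rewrite -(ci_cur I ltx) ?Ex // (label_le (ci_lab I)).
rewrite (@undecided_upd st u 1) //.
have: m - (i + ~~ nilp (having st 1)) <= undecided (set_reg st u 1); last by lia.
apply: (@undecided_ge _ h) => j /reps [w [ltw nw Ew hw]].
by exists w; rewrite /set_reg (negbTE nw).
Qed.

(** The digit is read off [h]. The work lies in showing that one is left: for each bag still to be
    opened, [complete_budget] wants a representative other than one chosen fringe vertex. *)
Lemma complete_branch st l h m i u r :
  complete_inv st l h m i -> connected a (fun w => vertex_of w && (st w == 3)) ->
  fringe st 2 = [::] -> fringe st 0 = u :: r ->
  ~~ [&& nilp (having st 1), nilp (having st 2) & nilp r] ->
  exists l' d, [/\ l = l'.+1, d < 3 & complete_inv (branch st u r d) l' h m i].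
Proof.
move=> I cM E2 E0 nforced; have [[h1 h2 h3 h4 h5] c1 c2 c3 c4 c5 [x ltx Ex] c8] := I.
have [ltu Eu nbu] := fringe_cons E0.
have h_fringe w : w < n -> st w = 0 -> (exists2 y, a w y & st y = 3) -> h w = i \/ h w = i.+1.
  move=> ltw Ew [y awy Ey]; have [_ lty] := a_lt awy.
  have := h3 y w lty ltw; rewrite a_sym => /(_ awy); rewrite (c3 y) ?Ey //.
  have := c2 w ltw; rewrite Ew; lia.
have far j : i + ~~ nilp (having st 1) < j <= m -> exists w, [/\ w < n, st w = 0 & h w = j].
  move=> /andP [ltj lej]; have [w ltw hw] := h2 j lej; exists w; split=> //.
  have := c1 w ltw; have := c2 w ltw; have := c3 w ltw; have := c4 w ltw.
  have := @having_notnil st 1 w ltw; lia.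
case: (boolP (nilp (having st 1))) => n1; last first.
  have: 0 < l.
    apply: (complete_budget I ltu Eu) => j Hj; have [w [ltw Ew hw]] := far j Hj.
    exists w; split=> //; apply/eqP=> Ewu; rewrite Ewu in hw.
    by have := h_fringe u ltu Eu nbu; rewrite n1 /= in Hj; lia.
  case: l I c8 => // l I c8 _; exists l, (h u != i : nat); split=> //; first by case: eqP.
  have brE : branch st u r (h u != i) = set_reg st u (if h u == i then 3 else 1).
    rewrite /branch; case: (h u == i) => //=; by case: (having st 1) n1.
  rewrite brE; apply: (complete_upd I) => //.
    by case: (h u =P i) => hu; [right | left; have := h_fringe u ltu Eu nbu; tauto].
  rewrite (having_upd_keep _ ltu _ n1) ?Eu //.
  move: c8; rewrite n1 (@undecided_upd st u (if h u == i then 3 else 1)) //; last by case: ifP.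
have n1' : having st 1 = [::] by apply/nilP.
case: (h_fringe u ltu Eu nbu) => hu.
  have: 0 < l.
    apply: (complete_budget I ltu Eu) => j Hj; have [w [ltw Ew hw]] := far j Hj.
    by exists w; split=> //; apply/eqP=> Ewu; rewrite Ewu in hw; lia.
  case: l I c8 => // l I c8 _; exists l, 0; split=> //=.
  rewrite /branch /=; apply: (complete_upd I) => //; first by right.
  move: c8; rewrite (@undecided_upd st u 3) //.
  suff -> : nilp (having (set_reg st u 3) 1) by rewrite n1; lia.
  apply: having_isnil => w ltw; rewrite /set_reg; case: (w =P u) => // _.
  exact: having_nil n1' w ltw.
(* If [u] opens the next bag and is the only fringe vertex, some [y] of the current bag is still
   unmarked. Leaving the marked part inside the bag towards [y] is possible only through [u], so
   this case is contradictory. *)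
case: r E0 nforced => [|u2 r] E0 nforced.
  have [y [lty Ey]] : exists y, y < n /\ st y = 2.
    move: nforced; rewrite n1 /= andbT; case E: (having st 2) => [//|y r] _.
    by exists y; apply: having_cons E.
  suff: st y == 3 by rewrite Ey.
  apply: (h4 i (fun w => st w == 3) _ x y);
    rewrite /vertex_of ?ltx ?lty ?(c3 y) ?(c3 x) ?Ex ?Ey ?eqxx //.
  move=> w z /andP [ltw /eqP hw] /andP [ltz /eqP hz] awz /eqP Ew.
  rewrite a_sym in awz.
  have z0 : st z <> 0 by move=> Ez; move: hz; rewrite (fringe_one E0 awz Ew Ez) hu; lia.
  have := c1 z ltz; have := c2 z ltz; have := c4 z ltz; have := fringe_nil E2 awz Ew; lia.
have [ltu2 nu2 Eu2 nbu2] := fringe_cons2 E0.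
have Eu2' : set_reg st u 1 u2 = 0 by rewrite /set_reg (negbTE nu2).
have hu2 := h_fringe u2 ltu2 Eu2 nbu2.
have: 0 < l.
  case: hu2 => hu2.
    apply: (complete_budget I ltu2 Eu2) => j Hj; have [w [ltw Ew hw]] := far j Hj.
    by exists w; split=> //; apply/eqP=> Ewu; rewrite Ewu in hw; lia.
  apply: (complete_budget I ltu Eu) => j Hj; have [w [ltw Ew hw]] := far j Hj.
  case: (eqVneq w u) => [Ewu|nw]; last by exists w.
  by exists u2; split=> //; rewrite -hw Ewu hu hu2.
case: l I c8 => // l I c8 _; exists l, (if h u2 == i then 1 else 2); split=> //.
  by case: ifP.
have -> : branch st u (u2 :: r) (if h u2 == i then 1 else 2) =
          set_reg (set_reg st u 1) u2 (if h u2 == i then 3 else 1).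
  by rewrite /branch n1'; case: (h u2 == i).
have I1 : complete_inv (set_reg st u 1) l.+1 h m i.
  apply: (complete_upd I) => //; first by left.
  rewrite having_upd_same //; move: c8; rewrite n1 (@undecided_upd st u 1) //; lia.
apply: (complete_upd I1) => //.
  by case: (h u2 =P i) => E; [right | left; lia].
have := ci_count I1; rewrite (having_upd_same st ltu (erefl 1)).
rewrite (@undecided_upd _ u2 (if h u2 == i then 3 else 1)) //; last by case: ifP.
rewrite (having_upd_keep _ ltu2 _ (having_upd_same st ltu (erefl 1))) ?Eu2' //; lia.
Qed.

Lemma branch_ge st u r d w : u < n -> (forall z, z \in u :: r -> st z = 0) ->
  st w <= branch st u r d w.
Proof.
move=> ltu H0; have Eu : st u = 0 by apply: H0; rewrite mem_head.
have U v : st w <= set_reg st u v w by rewrite /set_reg; case: (w =P u) => [->|//]; rewrite Eu.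
rewrite /branch; case: ifP => _ //; case: (having st 1) => //; case: r H0 => // u2 r H0.
rewrite {1}/set_reg; case: (w =P u2) => // ->.
by rewrite H0 // !inE eqxx orbT.
Qed.

Lemma branch_potential st u r d : fringe st 0 = u :: r ->
  potential (branch st u r d) < potential st.
Proof.
move=> E0; have [ltu Eu _] := fringe_cons E0.
have H0 z : z \in u :: r -> st z = 0.
  by rewrite -E0 mem_filter => /andP [/andP [/eqP]].
have nu : u \notin r.
  have: uniq (fringe st 0) by rewrite filter_uniq ?iota_uniq.
  by rewrite E0 => /andP [].
apply: (@potential_lt _ _ u) => //; rewrite ?Eu //.
  by move=> w _; apply: branch_ge.
rewrite /branch; case: ifP => _; first by rewrite /set_reg eqxx.
case: (having st 1) => [|? ?]; last by rewrite /set_reg eqxx.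
case: r nu {E0 H0} => [|u2 r]; first by rewrite /set_reg eqxx.
by rewrite inE negb_or /set_reg => /andP [/negbTE -> _]; rewrite eqxx.
Qed.

Lemma branch_marked st u r d : fringe st 0 = u :: r ->
  connected a (fun w => vertex_of w && (st w == 3)) ->
  connected a (fun w => vertex_of w && (branch st u r d w == 3)).
Proof.
move=> E0 cM.
have add st' w : w < n -> st' w = 0 -> (exists2 x, a w x & st' x = 3) ->
   connected a (fun w => vertex_of w && (st' w == 3)) -> forall v,
   connected a (fun z => vertex_of z && (set_reg st' w v z == 3)).
  move=> ltw Ew [x awx Ex] cM' v; have [_ ltx] := a_lt awx.
  case: (eqVneq v 3) => [->|nv].
    apply: (connected_add (y := w) (x := x)) cM' _ _ _; rewrite ?(a_sym x) //.
      by rewrite /vertex_of ltx Ex.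
    by move=> z; rewrite /set_reg /vertex_of; case: (z =P w) => [->|//]; rewrite ltw.
  apply: connected_ext cM' => z; rewrite /set_reg; case: (z =P w) => [->|//].
  by rewrite Ew (negbTE nv).
have [ltu Eu nbu] := fringe_cons E0.
rewrite /branch; case: ifP => _; first exact: add.
case: (having st 1) => [|? ?]; last exact: add.
case: r E0 => [|u2 r] E0; first exact: add.
have [ltu2 nu2 Eu2 [x aux Ex]] := fringe_cons2 E0.
apply: (add) => //; last exact: add.
  by rewrite /set_reg (negbTE nu2).
exists x => //; rewrite /set_reg; case: (x =P u) => // E; by rewrite E Eu in Ex.
Qed.

(** Induction on the fuel. The word is assembled from its end: the remaining run yields the lower
    digits, and a branching step puts its digit in front. *)
Lemma accept_complete f st l b h m i :
  complete_inv st l h m i -> connected a (fun w => vertex_of w && (st w == 3)) ->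
  potential st < f -> exists2 s, s < 3 ^ l & acc (iter f micro (Sim st l s b)).
Proof.
elim: f st l h m i => // f IH st l h m i I cM; rewrite ltnS => ltf.
have [[h1 h2 h3 h4 h5] c1 c2 c3 c4 c5 [x ltx Ex] c8] := I.
have pow0 : 0 < 3 ^ l by rewrite expn_gt0.
case E2: (fringe st 2) => [|z r2].
  case E0: (fringe st 0) => [|u r].
    have nf2 := fringe_nil E2; have nf0 := fringe_nil E0.
    (* With both fringes empty the marked part is closed in bag [i] of [h], so it is the whole
       bag. *)
    have bag w : w < n -> h w = i -> st w = 3.
      move=> ltw hw; apply/eqP; apply: (h4 i (fun w => st w == 3) _ x w);
        rewrite /vertex_of ?ltx ?ltw ?hw ?(c3 x) ?Ex ?eqxx //.
      move=> y z /andP [lty /eqP hy] /andP [ltz /eqP hz] ayz /eqP Ey.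
      rewrite a_sym in ayz; have := nf2 z y ayz Ey; have := nf0 z y ayz Ey.
      have := c1 z ltz; have := c2 z ltz; have := c4 z ltz; lia.
    have H2 : having st 2 = [::].
      by apply/nilP/having_isnil => w ltw Ew; have := bag w ltw; rewrite (c3 w) ?Ew //; lia.
    have no2 := having_nil H2.
    case H1: (having st 1) => [|y r1].
      have no1 := having_nil H1.
      (* The graph is connected and no edge leads from a marked or past vertex to any other status,
         so nothing is undecided. *)
      have H0 : having st 0 = [::].
        apply/nilP/having_isnil => w ltw Ew.
        suff: 3 <= st w by rewrite Ew.
        apply: (h5 (fun w => 3 <= st w) _ x w) => //; last by rewrite Ex.
        move=> y z lty ltz ayz; rewrite leq_eqVlt => /orP [/eqP Ey|gty].
          rewrite a_sym in ayz; have := nf2 z y ayz; have := nf0 z y ayz.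
          have := no1 z ltz; lia.
        have Ey : st y = 4 by have := c1 y lty; lia.
        have := c5 y z ayz Ey; have := no2 z ltz; lia.
      exists 0 => //; rewrite iterSr /= E2 E0 H2 H1 H0; exact: iter_micro_acc.
    have [lty Ey] := having_cons H1.
    have advE w : advance st y w = if w == y then 3 else if st w == 3 then 4
            else if st w == 1 then 2 else st w by [].
    (* The inhabited next bag, counted apart in [ci_count], is from now on counted by [i.+1]. *)
    have I' : complete_inv (advance st y) l h m i.+1.
      split=> //.
      - by move=> w ltw; rewrite advE; have := c1 w ltw; iflia.
      - move=> w ltw; rewrite advE ltnS leq_eqVlt -(c2 w ltw).
        have := c4 w ltw; have := c3 w ltw; have := bag w ltw; have := c2 w ltw.
        by case: (w =P y) => [->|_]; rewrite ?Ey; iflia.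
      - move=> w ltw; rewrite advE.
        have := c4 w ltw; have := no2 w ltw.
        by case: (w =P y) => [->|_]; rewrite ?Ey; iflia.
      - by move=> w ltw; rewrite advE; iflia.
      - move=> w u awu; have [ltw ltu] := a_lt awu; rewrite !advE.
        have := c5 w u awu; have := c1 u ltu.
        rewrite a_sym in awu; have := nf0 u w awu; iflia.
      - by exists y => //; rewrite advE eqxx.
      - rewrite (@undecided_eq (advance st y) st); last first.
          by move=> w ltw; rewrite advE //; case: (w =P y) => [->|]; rewrite ?Ey //; iflia.
        have -> : nilp (having (advance st y) 1).
          by apply: having_isnil => w ltw; rewrite advE; iflia.
        by move: c8; rewrite H1 /=; lia.
    have [||s lts Hs] := IH _ _ _ _ _ I'.
    - move=> A clA w u.
      have only z : vertex_of z && (advance st y z == 3) -> z = y by rewrite advE; iflia.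
      by move=> /only -> /only ->.
    - apply: leq_trans ltf; apply: (@potential_lt _ _ y) => //; rewrite ?advE ?eqxx ?Ey //.
      by move=> w _; rewrite advE; case: (w =P y) => [->|]; rewrite ?Ey //; iflia.
    by exists s => //; rewrite iterSr /= E2 E0 H2 H1.
  have [ltu Eu nbu] := fringe_cons E0.
  case: (boolP (nilp (having st 1) && nilp (having st 2) && nilp r)) => [forced|nforced].
    case/andP: (forced) => /andP [/nilP H1 /nilP H2] /nilP Er; rewrite Er in E0.
    have cM' : connected a (fun w => vertex_of w && (set_reg st u 1 w == 3)).
      apply: connected_ext cM => w; rewrite /set_reg; case: (w =P u) => [->|//].
      by rewrite Eu.
    have ltf' : potential (set_reg st u 1) < f.
      by apply: leq_trans ltf; apply: potential_upd; rewrite ?Eu.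
    (* The forced move puts [u] into the next bag. If the given labelling has [u] in bag [i],
       cutting that bag yields another one that agrees with the move. *)
    have [h' [m' I']] : exists h' m', complete_inv (set_reg st u 1) l h' m' i.
      have hu : h u = i \/ h u = i.+1.
        have [y auy Ey] := nbu; have [_ lty] := a_lt auy.
        have := h3 y u lty ltu; rewrite a_sym => /(_ auy); rewrite (c3 y) ?Ey //.
        have := c2 u ltu; rewrite Eu; lia.
      have cnt : undecided (set_reg st u 1) + i + 1 <= l + m.
        by move: c8; rewrite H1 (@undecided_upd st u 1) //=; lia.
      case: hu => hu; last first.
        exists h, m; apply: (complete_upd I) => //; first by left.
        by rewrite having_upd_same.
      have L := labelling_split I cM E2 E0 H1 H2 hu.
      set h' := fun w => _ in L.
      have I0 : complete_inv st l h' m.+1 i.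
        split=> //; last by rewrite H1 /=; move: c8; rewrite H1 /=; lia.
        - move=> w ltw; rewrite c2 // /h'; have := c3 w ltw.
          by case: (st w =P 3) => [->|_] /=; iflia.
        - move=> w ltw Hw; have := having_nil H2 ltw; have := c3 w ltw Hw.
          by rewrite /h'; case: (st w =P 3) => [_|n3] /=; lia.
        - by move=> w ltw Ew; case: (having_nil H1 ltw).
        - by exists x.
      exists h', m.+1; apply: (complete_upd I0) => //.
        by left; rewrite /h' Eu hu ltnn.
      by rewrite having_upd_same //; lia.
    have [s lts Hs] := IH _ _ _ _ _ I' cM' ltf'.
    by exists s => //; rewrite iterSr /= E2 E0 H1 H2.
  have [|l' [d [El ltd I']]] := complete_branch I cM E2 E0; first by rewrite andbA.
  have [s lts Hs] := IH _ _ _ _ _ I' (branch_marked E0 cM)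
                       (leq_trans (branch_potential d E0) ltf).
  have pow0' : 0 < 3 ^ l' by rewrite expn_gt0.
  exists (d * 3 ^ l' + s).
    rewrite El expnS -addnS; apply: (@leq_trans (d * 3 ^ l' + 3 ^ l')).
      by rewrite leq_add2l.
    by rewrite -mulSnr leq_mul2r ltd orbT.
  rewrite iterSr /= E2 E0 (negbTE nforced) El.
  by rewrite divnMDl // modnMDl divn_small // modn_small // addn0.
have [ltz Ez [y azy Ey]] := fringe_cons E2; have [_ lty] := a_lt azy.
have ltf' : potential (set_reg st z 3) < f.
  by apply: leq_trans ltf; apply: potential_upd; rewrite ?Ez.
have cM' : connected a (fun w => vertex_of w && (set_reg st z 3 w == 3)).
  apply: (connected_add (y := z) (x := y)) cM _ _ _; rewrite ?(a_sym y) //.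
    by rewrite /vertex_of lty Ey.
  by move=> w; rewrite /set_reg /vertex_of; case: (w =P z) => [->|//]; rewrite ltz.
have I' : complete_inv (set_reg st z 3) l h m i.
  have stn w : w != z -> set_reg st z 3 w = st w by rewrite /set_reg => /negbTE ->.
  have stz : set_reg st z 3 z = 3 by rewrite /set_reg eqxx.
  split=> //.
  - by move=> w ltw; case: (eqVneq w z) => [->|nw]; [rewrite stz | rewrite stn ?c1].
  - move=> w ltw; case: (eqVneq w z) => [->|nw]; last by rewrite stn ?c2.
    by rewrite stz -c2 // Ez.
  - move=> w ltw; case: (eqVneq w z) => [->|nw]; last by rewrite stn //; apply: c3.
    by move=> _; apply: c3; rewrite ?Ez.
  - by move=> w ltw; case: (eqVneq w z) => [->|nw]; [rewrite stz | rewrite stn //; apply: c4].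
  - move=> w u awu; case: (eqVneq w z) => [->|nw]; first by rewrite stz.
    rewrite stn // => E4; case: (eqVneq u z) => [->|nu]; first by rewrite stz.
    by rewrite stn //; apply: c5 awu E4.
  - by exists z.
  - rewrite (@undecided_eq _ st); last first.
      by move=> w ltw; case: (eqVneq w z) => [->|nw]; [rewrite stz Ez | rewrite stn].
    apply: leq_trans c8; rewrite leq_add2l.
    case: (boolP (nilp (having st 1))) => [/nilP n1|n1] /=; last exact: leq_b1.
    rewrite leqn0 eqb0 negbK; apply: having_isnil => w ltw.
    by case: (eqVneq w z) => [->|nw]; [rewrite stz | rewrite stn //; apply: having_nil n1 w ltw].
have [s lts Hs] := IH _ _ _ _ _ I' cM' ltf'.
by exists s => //; rewrite iterSr /= E2.
Qed.

Theorem acceptsP k :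
  (exists v s, [/\ v < n, s < 3 ^ k & accepts v k s]) <-> solvable k.
Proof.
split=> [[v [s [ltv _]]]|[h [m [L len]]]]; first exact: accepts_sound.
have [v ltv hv] := label_surj L (leq0n m).
have stE w : set_reg (fun=> 0) v 3 w = if w == v then 3 else 0 by [].
have I : complete_inv (set_reg (fun=> 0) v 3) k h m 0.
  split=> //.
  - by move=> w _; rewrite stE; case: (w =P v).
  - by move=> w _; rewrite stE; case: (w =P v).
  - by move=> w _; rewrite stE; case: (w =P v) => // ->.
  - by move=> w _; rewrite stE; case: (w =P v).
  - by move=> w u _; rewrite stE; case: (w =P v).
  - by exists v; rewrite ?stE ?eqxx.
  - have -> : nilp (having (set_reg (fun=> 0) v 3) 1).
      by apply: having_isnil => w _; rewrite stE; case: (w =P v).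
    have := @undecided_upd (fun=> 0) v 3 ltv erefl erefl.
    rewrite {1}/undecided /= sum1_size size_iota; lia.
have [||s lts Hs] := @accept_complete (4 * n).+1 _ _ false _ _ _ I.
- have only w : vertex_of w && (set_reg (fun=> 0) v 3 w == 3) -> w = v.
    by rewrite stE; case: (w =P v) => //; rewrite andbF.
  by move=> A _ w u /only -> /only ->.
- rewrite ltnS /potential; apply: leq_trans (_ : \sum_(w <- vs) 4 <= _).
    by apply: leq_sum => w _; apply: leq_subr.
  by rewrite big_const_seq count_predT size_iota iter_addn_0.
by exists v, s.
Qed.
End Search.

(** * A language of bounded loops *)

Record store := MkStore { var : nat -> nat; arr : nat -> nat -> nat; inp : seq nat }.

Definition setv s x v := MkStore (set_reg (var s) x v) (arr s) (inp s).
Definition seta s j i v :=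
  MkStore (var s) (fun j' => if j' == j then set_reg (arr s j) i v else arr s j') (inp s).

(* [CLoop x b c] runs c with x = N-1, ..., 0, where N is the initial value of x;
   b names a bound on N and is only used to measure time. *)
Inductive cmd :=
  | CSkip
  | CConst of nat & nat
  | CAdd of nat & nat & nat
  | CSub of nat & nat & nat
  | CGet of nat & nat & nat
  | CPut of nat & nat & nat
  | CRead of nat
  | CSeq of cmd & cmd
  | CIf of nat & cmd & cmd
  | CLoop of nat & nat & cmd.

(** Each round sets [x] anew, so the meaning of a loop does not depend on its body sparing the
    counter. The compiled loop keeps its count in [x] itself, hence the condition on [assigned] in
    [wf]. *)
Fixpoint down (f : store -> store) x N s :=
  if N is N'.+1 then down f x N' (f (setv s x N')) else s.

Fixpoint run (c : cmd) (s : store) : store :=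
  match c with
  | CSkip => s
  | CConst x v => setv s x v
  | CAdd x y z => setv s x (var s y + var s z)
  | CSub x y z => setv s x (var s y - var s z)
  | CGet x j y => setv s x (arr s j (var s y))
  | CPut j y z => seta s j (var s y) (var s z)
  | CRead x => MkStore (set_reg (var s) x (head 0 (inp s))) (arr s) (behead (inp s))
  | CSeq c1 c2 => run c2 (run c1 s)
  | CIf x c1 c2 => if 0 < var s x then run c1 s else run c2 s
  | CLoop x _ c => down (run c) x (var s x) s
  end.

Fixpoint assigned (c : cmd) : seq nat :=
  match c with
  | CSkip | CPut _ _ _ => [::]
  | CConst x _ | CAdd x _ _ | CSub x _ _ | CGet x _ _ | CRead x => [:: x]
  | CSeq c1 c2 | CIf _ c1 c2 => assigned c1 ++ assigned c2
  | CLoop x _ c => x :: assigned c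
  end.

Fixpoint stored (c : cmd) : seq nat :=
  match c with
  | CPut j _ _ => [:: j]
  | CSeq c1 c2 | CIf _ c1 c2 => stored c1 ++ stored c2
  | CLoop _ _ c => stored c
  | _ => [::]
  end.

Definition frame (xs js : seq nat) s s' :=
  (forall x, x \notin xs -> var s' x = var s x) /\
  (forall j, j \notin js -> arr s' j = arr s j).

Lemma frame_refl xs js s : frame xs js s s.
Proof. by []. Qed.

Lemma frame_trans xs js s1 s2 s3 :
  frame xs js s1 s2 -> frame xs js s2 s3 -> frame xs js s1 s3.
Proof.
by move=> [v1 a1] [v2 a2]; split=> [x nx|j nj]; rewrite ?v2 ?v1 ?a2 ?a1.
Qed.

Lemma frame_sub xs js xs' js' s s' :
  {subset xs <= xs'} -> {subset js <= js'} -> frame xs js s s' -> frame xs' js' s s'.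
Proof.
move=> sx sj [v a]; split=> [x nx|j nj]; [apply: v | apply: a].
  by apply: contra nx; apply: sx.
by apply: contra nj; apply: sj.
Qed.

Lemma frame_setv xs js s x v : x \in xs -> frame xs js s (setv s x v).
Proof.
move=> inx; split=> // y ny /=; rewrite /set_reg; case: eqP => // E.
by rewrite E inx in ny.
Qed.

Lemma run_frame c s : frame (assigned c) (stored c) s (run c s).
Proof.
elim: c s => [|x v|x y z|x y z|x j y|j y z|x|c1 IH1 c2 IH2|x c1 IH1 c2 IH2|x b c IH] s /=;
  try by apply: frame_setv; rewrite mem_head.
- exact: frame_refl.
- split=> // j' /=; rewrite inE => /negbTE nj.
  by rewrite nj.
- apply: (@frame_trans _ _ _ (run c1 s)).
    by apply: frame_sub (IH1 s) => y; rewrite mem_cat => ->.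
  by apply: frame_sub (IH2 _) => y; rewrite mem_cat => ->; rewrite orbT.
- case: ifP => _.
    by apply: frame_sub (IH1 s) => y; rewrite mem_cat => ->.
  by apply: frame_sub (IH2 _) => y; rewrite mem_cat => ->; rewrite orbT.
- move: (var s x) => N; elim: N s => [|N IHN] s /=; first exact: frame_refl.
  apply: frame_trans (IHN _); apply: (@frame_trans _ _ _ (setv s x N)).
    by apply: frame_setv; rewrite mem_head.
  by apply: frame_sub (IH _) => // y; rewrite inE orbC => ->.
Qed.

Section Bounds.
Variables (eps : nat -> nat) (B : nat).

Fixpoint okdown (P : store -> Prop) (f : store -> store) x N s : Prop :=
  if N is N'.+1 then P (setv s x N') /\ okdown P f x N' (f (setv s x N')) else True.

(* The run keeps all written values at most B and all loop counters within
   their declared bounds. *)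
Fixpoint ok (c : cmd) (s : store) : Prop :=
  match c with
  | CConst x v => v <= B
  | CAdd x y z => var s y + var s z <= B
  | CRead x => head 0 (inp s) <= B
  | CSeq c1 c2 => ok c1 s /\ ok c2 (run c1 s)
  | CIf x c1 c2 => if 0 < var s x then ok c1 s else ok c2 s
  | CLoop x b c => var s x <= eps b /\ okdown (ok c) (run c) x (var s x) s
  | _ => True
  end.

(** The unit is one instruction. An array access takes four for the address and one for the access;
    a round of a loop adds one test, two to decrement and two to jump back; leaving it takes a test
    and a jump of two. Adding both branches of [CIf] avoids a maximum. *)
Fixpoint time (c : cmd) : nat :=
  match c with
  | CSkip => 0
  | CGet _ _ _ | CPut _ _ _ => 5
  | CSeq c1 c2 => time c1 + time c2
  | CIf _ c1 c2 => 3 + time c1 + time c2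
  | CLoop _ b c => eps b * (time c + 5) + 3
  | _ => 1
  end.

Definition wpre c (Q : store -> Prop) s := ok c s /\ Q (run c s).

Lemma wp_seq c1 c2 Q s : wpre c1 (fun s' => wpre c2 Q s') s -> wpre (CSeq c1 c2) Q s.
Proof. by case=> o1 [o2 q]. Qed.

Lemma wp_if x c1 c2 Q s :
  (if 0 < var s x then wpre c1 Q s else wpre c2 Q s) -> wpre (CIf x c1 c2) Q s.
Proof. by rewrite /wpre /=; case: ifP. Qed.

Lemma wp_weak c (Q Q' : store -> Prop) s :
  (forall s', frame (assigned c) (stored c) s s' -> Q s' -> Q' s') ->
  wpre c Q s -> wpre c Q' s.
Proof. by move=> H [o q]; split=> //; apply: H q; apply: run_frame. Qed.

(** [Inv] is indexed by the rounds still to run. The frame relates every round to the initial store,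
    so an invariant need only mention what the body changes. *)
Lemma wp_loop x b c (Inv : nat -> store -> Prop) (Q : store -> Prop) s :
  var s x <= eps b -> Inv (var s x) s ->
  (forall j s', j < var s x -> frame (x :: assigned c) (stored c) s s' ->
     Inv j.+1 s' -> wpre c (Inv j) (setv s' x j)) ->
  (forall s', frame (x :: assigned c) (stored c) s s' -> Inv 0 s' -> Q s') ->
  wpre (CLoop x b c) Q s.
Proof.
move=> leN I0 Istep Iend.
suff H N s' : N <= var s x -> frame (x :: assigned c) (stored c) s s' -> Inv N s' ->
   okdown (ok c) (run c) x N s' /\ Q (down (run c) x N s').
  have [o q] := H _ s (leqnn _) (frame_refl _ _ s) I0; by split.
elim: N s' => [|N IH] s' lt F I /=; first by split=> //; apply: Iend.
have [o q] := Istep N s' lt F I.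
have [|o' q'] := IH (run c (setv s' x N)) (ltnW lt) _ q; last by [].
apply: (frame_trans F); apply: (@frame_trans _ _ _ (setv s' x N)).
  by apply: frame_setv; rewrite mem_head.
by apply: frame_sub (run_frame c _) => // y; rewrite inE orbC => ->.
Qed.

End Bounds.

(** * Compilation to random access machines *)

(* Registers 0-29 hold the variables, 30 and 31 are temporaries, and cell i of
   array j < 4 is register 32 + 4 i + j. *)
Definition cell i j := 32 + (4 * i + j).

Definition address y j : seq instr :=
  [:: Add 30 y y; Add 30 30 30; Const 31 (32 + j); Add 30 30 31].

(** Jumps are absolute, so the code depends on its start [p]. As [Jump] tests for a positive
    register, unconditional jumps load 1 into register 31 beforehand, and the else branch precedes
    the then branch. *)
Fixpoint compile p (c : cmd) : program :=
  match c with
  | CSkip => [::]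
  | CConst x v => [:: Const x v]
  | CAdd x y z => [:: Add x y z]
  | CSub x y z => [:: Defs.Sub x y z]
  | CGet x j y => address y j ++ [:: Fetch x 30]
  | CPut j y z => address y j ++ [:: Store 30 z]
  | CRead x => [:: Read x]
  | CSeq c1 c2 => compile p c1 ++ compile (p + size (compile p c1)) c2
  | CIf x c1 c2 =>
      let l2 := compile p.+1 c2 in
      let p1 := p.+1 + size l2 + 2 in
      let l1 := compile p1 c1 in
      Jump p1 x :: l2 ++ [:: Const 31 1, Jump (p1 + size l1) 31 & l1]
  | CLoop x _ c =>
      let l := compile (p + 5) c in
      [:: Jump (p + 3) x; Const 31 1; Jump (p + 7 + size l) 31;
          Const 31 1; Defs.Sub x x 31] ++ l ++ [:: Const 31 1; Jump p 31]
  end.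

Fixpoint wf (c : cmd) : bool :=
  match c with
  | CSkip => true
  | CConst x _ | CRead x => x < 30
  | CAdd x y z | CSub x y z => [&& x < 30, y < 30 & z < 30]
  | CGet x j y | CPut j x y => [&& x < 30, j < 4 & y < 30]
  | CSeq c1 c2 => wf c1 && wf c2
  | CIf x c1 c2 => [&& x < 30, wf c1 & wf c2]
  | CLoop x _ c => [&& x < 30, x \notin assigned c & wf c]
  end.

Definition represents (r : nat -> nat) s :=
  (forall x, x < 30 -> r x = var s x) /\
  (forall i j, j < 4 -> r (cell i j) = arr s j i).

Lemma represents_tmp r s t v : represents r s -> 30 <= t < 32 ->
  represents (set_reg r t v) s.
Proof.
move=> [Hv Ha] Ht; split=> [x ltx|i j ltj]; rewrite /set_reg.
  by rewrite -Hv //; case: (x =P t) => //; lia.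
by rewrite -Ha //; case: (cell i j =P t) => //; rewrite /cell; lia.
Qed.

Lemma represents_setv r s x v : represents r s -> x < 30 ->
  represents (set_reg r x v) (setv s x v).
Proof.
move=> [Hv Ha] ltx; split=> [y lty|i j ltj]; rewrite /set_reg /=.
  by rewrite /set_reg Hv.
by rewrite -Ha //; case: (cell i j =P x) => //; rewrite /cell; lia.
Qed.

Lemma represents_seta r s i j v : represents r s -> j < 4 ->
  represents (set_reg r (cell i j) v) (seta s j i v).
Proof.
move=> [Hv Ha] ltj; split=> [y lty|i' j' ltj']; rewrite /set_reg /=.
  by rewrite Hv //; case: (y =P cell i j) => //; rewrite /cell; lia.
case: (j' =P j) => [->|nj].
  rewrite /set_reg -Ha //; case: (i' =P i) => [->|ni]; first by rewrite eqxx.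
  by case: (cell i' j =P cell i j) => //; rewrite /cell; lia.
by rewrite -Ha //; case: (cell i' j' =P cell i j) => //; rewrite /cell; lia.
Qed.

Definition code_at (P : program) p l := exists pre post, P = pre ++ l ++ post /\ size pre = p.

Lemma code_at_cat P p l1 l2 :
  code_at P p (l1 ++ l2) -> code_at P p l1 /\ code_at P (p + size l1) l2.
Proof.
case=> pre [post [-> <-]]; split.
  by exists pre, (l2 ++ post); rewrite -catA.
by exists (pre ++ l1), post; rewrite size_cat !catA.
Qed.

Lemma code_at_cons P p I l :
  code_at P p (I :: l) -> onth P p = Some I /\ code_at P p.+1 l.
Proof.
case=> pre [post [-> <-]]; split; last by exists (rcons pre I), post; rewrite size_rcons cat_rcons.
by rewrite onth_cat ltnn subnn.
Qed.

(** Stated through continuations of [halts], so that runs compose and the cost of the rest is simply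
    added. *)
Definition reach P s T s' :=
  exists2 t, t <= T & forall t' s'', halts P s' t' s'' -> halts P s (t + t') s''.

Lemma reach_refl P s T : reach P s T s.
Proof. by exists 0. Qed.

Lemma reach_trans P s1 T1 s2 T2 s3 T :
  reach P s1 T1 s2 -> reach P s2 T2 s3 -> T1 + T2 <= T -> reach P s1 T s3.
Proof.
case=> t1 le1 H1 [t2 le2 H2] leT; exists (t1 + t2); first by lia.
by move=> t' s'' /H2 /H1; rewrite addnA.
Qed.

Lemma reach_step P p r w I s' T :
  onth P p = Some I -> cost I (Config p r w) <= T -> step I (Config p r w) = s' ->
  reach P (Config p r w) T s'.
Proof.
move=> E le <-; exists (cost I (Config p r w)) => // t' s'' H.
exact: halts_step H.
Qed.

Lemma leq_bitlen u v : u <= v -> bitlen u <= bitlen v.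
Proof. by move=> le; rewrite ltnS; apply: leq_trunc_log. Qed.

Section Correct.
Variables (eps : nat -> nat) (B : nat).

Definition bounded s :=
  (forall x, x < 30 -> var s x <= B) /\ (forall i j, j < 4 -> arr s j i <= B).

(** An instruction is charged for at most two numbers: contents are bounded by [B] and addresses by
    [cell B 3], which is [4 * B + 35]. *)
Definition word_cost := 2 * bitlen (4 * B + 40).
Local Notation W := word_cost.

Lemma bitlen_le u : u <= 4 * B + 40 -> bitlen u <= bitlen (4 * B + 40).
Proof. exact: leq_bitlen. Qed.

Lemma word_cost_gt0 : 2 <= W.
Proof. by rewrite /word_cost /bitlen mulnS. Qed.

Lemma bounded_setv s x v : bounded s -> v <= B -> bounded (setv s x v).
Proof.
by move=> [Hv Ha] le; split=> // y lty /=; rewrite /set_reg; case: eqP => // _; apply: Hv.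
Qed.

Lemma bounded_seta s j i v : bounded s -> v <= B -> bounded (seta s j i v).
Proof.
move=> [Hv Ha] le; split=> // i' j' ltj' /=; case: (j' =P j) => [E|_]; last exact: Ha.
by rewrite /set_reg; case: eqP => // _; rewrite -E; apply: Ha.
Qed.

Lemma address_reach P p y j r w s : code_at P p (address y j) -> y < 30 -> j < 4 ->
  represents r s -> bounded s ->
  exists r', [/\ reach P (Config p r w) (4 * W) (Config (p + 4) r' w),
    represents r' s & r' 30 = cell (var s y) j].
Proof.
move=> /code_at_cons [o1 /code_at_cons [o2 /code_at_cons [o3 /code_at_cons [o4 _]]]] lty ltj R [Bv Ba].
have By := Bv y lty; have Ry := R.1 y lty.
have W2 : 2 <= W := word_cost_gt0.
set r1 := set_reg r 30 (r y + r y).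
set r2 := set_reg r1 30 (r1 30 + r1 30).
set r3 := set_reg r2 31 (32 + j).
set r4 := set_reg r3 30 (r3 30 + r3 31).
have R1 : represents r1 s by apply: represents_tmp.
have R2 : represents r2 s by apply: represents_tmp.
have R3 : represents r3 s by apply: represents_tmp.
exists r4; split; last 2 first.
- exact: represents_tmp.
- by rewrite /r4 /r3 /r2 /r1 /cell /set_reg /= Ry; lia.
have S1 : reach P (Config p r w) W (Config p.+1 r1 w).
  apply: (reach_step o1) => //=; rewrite /word_cost mul2n -addnn.
  by apply: leq_add; apply: bitlen_le; lia.
have S2 : reach P (Config p.+1 r1 w) W (Config p.+2 r2 w).
  apply: (reach_step o2) => //=; rewrite /word_cost mul2n -addnn.
  by apply: leq_add; apply: bitlen_le; rewrite /r1 /set_reg /=; lia.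
have S3 : reach P (Config p.+2 r2 w) W (Config p.+3 r3 w).
  by apply: (reach_step o3) => //=; lia.
have S4 : reach P (Config p.+3 r3 w) W (Config p.+4 r4 w).
  apply: (reach_step o4) => //=; rewrite /word_cost mul2n -addnn.
  by apply: leq_add; apply: bitlen_le; rewrite /r3 /r2 /r1 /set_reg /=; lia.
rewrite addn4; apply: (reach_trans S1 (reach_trans S2 (reach_trans S3 S4 (leqnn _)) (leqnn _))); lia.
Qed.

Lemma jump_reach P p q r w :
  onth P p = Some (Const 31 1) -> onth P p.+1 = Some (Jump q 31) ->
  reach P (Config p r w) (2 * W) (Config q (set_reg r 31 1) w).
Proof.
move=> o1 o2; have W2 : 2 <= W := word_cost_gt0.
have S1 : reach P (Config p r w) W (Config p.+1 (set_reg r 31 1) w).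
  by apply: (reach_step o1) => //=; lia.
have S2 : reach P (Config p.+1 (set_reg r 31 1) w) W (Config q (set_reg r 31 1) w).
  by apply: (reach_step o2) => //=; rewrite /set_reg /= /bitlen; lia.
by apply: (reach_trans S1 S2); lia.
Qed.

Lemma test_reach P p q x r w s : onth P p = Some (Jump q x) -> x < 30 ->
  represents r s -> bounded s ->
  reach P (Config p r w) W (Config (if 0 < var s x then q else p.+1) r w).
Proof.
move=> o ltx R [Bv _]; apply: (reach_step o); rewrite /= R.1 //.
apply: (@leq_trans (bitlen (4 * B + 40))); last by rewrite /word_cost; lia.
by apply: bitlen_le; have := Bv x ltx; lia.
Qed.

Lemma compile_correct P c p r s :
  code_at P p (compile p c) -> wf c -> ok eps B c s -> bounded s -> represents r s ->
  exists r', [/\ reach P (Config p r (inp s)) (time eps c * W)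
                   (Config (p + size (compile p c)) r' (inp (run c s))),
                 represents r' (run c s) & bounded (run c s)].
Proof.
have W2 : 2 <= W := word_cost_gt0.
elim: c p r s => [|x v|x y z|x y z|x j y|j y z|x|c1 IH1 c2 IH2|x c1 IH1 c2 IH2|x b c IH]
  p r s /=.
- move=> _ _ _ Bs R; exists r; rewrite addn0; split=> //; exact: reach_refl.
- move=> /code_at_cons [o _] ltx lev Bs R; exists (set_reg r x v); rewrite addn1 mul1n; split.
  + by apply: (reach_step o) => //=; lia.
  + exact: represents_setv.
  + by apply: bounded_setv.
- move=> /code_at_cons [o _] /and3P [ltx lty ltz] lev Bs R.
  exists (set_reg r x (r y + r z)); rewrite addn1 mul1n; split.
  + apply: (reach_step o) => //=; rewrite /word_cost mul2n -addnn !R.1 //.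
    by apply: leq_add; apply: bitlen_le; lia.
  + by rewrite !R.1 //; apply: represents_setv.
  + by apply: bounded_setv.
- move=> /code_at_cons [o _] /and3P [ltx lty ltz] _ Bs R.
  have By := Bs.1 y lty; have Bz := Bs.1 z ltz.
  exists (set_reg r x (r y - r z)); rewrite addn1 mul1n; split.
  + apply: (reach_step o) => //=; rewrite /word_cost mul2n -addnn !R.1 //.
    by apply: leq_add; apply: bitlen_le; lia.
  + by rewrite !R.1 //; apply: represents_setv.
  + by apply: bounded_setv => //; lia.
- move=> C /and3P [ltx ltj lty] _ Bs R.
  have [C1 C2] := code_at_cat (l1 := address y j) (l2 := [:: Fetch x 30]) C.
  case/code_at_cons: C2 => o _.
  have [r1 [S1 R1 E1]] := address_reach (inp s) C1 lty ltj R Bs.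
  have By := Bs.1 y lty; have Ba := Bs.2 (var s y) j ltj.
  have E2 : r1 (r1 30) = arr s j (var s y) by rewrite E1 R1.2.
  exists (set_reg r1 x (r1 (r1 30))); split.
  + rewrite addnS; apply: (reach_trans S1) (_ : reach _ _ W _) _; last by lia.
    apply: (reach_step o) => //=; rewrite /word_cost mul2n -addnn E1 R1.2 //.
    by apply: leq_add; apply: bitlen_le; rewrite /cell; lia.
  + by rewrite E2; apply: represents_setv.
  + by apply: bounded_setv.
- move=> C /and3P [lty ltj ltz] _ Bs R.
  have [C1 C2] := code_at_cat (l1 := address y j) (l2 := [:: Store 30 z]) C.
  case/code_at_cons: C2 => o _.
  have [r1 [S1 R1 E1]] := address_reach (inp s) C1 lty ltj R Bs.
  have By := Bs.1 y lty; have Bz := Bs.1 z ltz.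
  exists (set_reg r1 (r1 30) (r1 z)); split.
  + rewrite addnS; apply: (reach_trans S1) (_ : reach _ _ W _) _; last by lia.
    apply: (reach_step o) => //=; rewrite /word_cost mul2n -addnn E1 R1.1 //.
    by apply: leq_add; apply: bitlen_le; rewrite /cell; lia.
  + by rewrite E1 R1.1 //; apply: represents_seta.
  + exact: bounded_seta.
- move=> /code_at_cons [o _] ltx lev Bs R.
  exists (set_reg r x (head 0 (inp s))); rewrite addn1 mul1n; split.
  + apply: (reach_step o) => //=.
    apply: (@leq_trans (bitlen (4 * B + 40))); last by rewrite /word_cost; lia.
    by apply: bitlen_le; lia.
  + exact: (represents_setv (s := s)).
  + exact: (bounded_setv (s := s)).
- move=> /code_at_cat [C1 C2] /andP [w1 w2] [o1 o2] Bs R.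
  have [r1 [S1 R1 B1]] := IH1 _ _ _ C1 w1 o1 Bs R.
  have [r2 [S2 R2 B2]] := IH2 _ _ _ C2 w2 o2 B1 R1.
  exists r2; split=> //; rewrite size_cat addnA.
  by apply: (reach_trans S1 S2); rewrite mulnDl.
- set l2 := compile p.+1 c2; set p1 := p.+1 + size l2 + 2; set l1 := compile p1 c1.
  move=> /code_at_cons [o /code_at_cat [C2 /code_at_cons [oc /code_at_cons [oj C1]]]].
  move=> /and3P [ltx w1 w2] okc Bs R.
  have S0 := test_reach (inp s) o ltx R Bs.
  have Ep1 : p1 = (p.+1 + size l2).+2 by rewrite /p1; lia.
  case: ifP okc S0 => [_|_] oks S0.
    rewrite -Ep1 in C1.
    have [r1 [S1 R1 B1]] := IH1 _ _ _ C1 w1 oks Bs R.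
    exists r1; split=> //.
    rewrite size_cat /= (_ : p + _ = p1 + size l1); last by rewrite Ep1; lia.
    by apply: (reach_trans S0 S1); lia.
  have [r1 [S1 R1 B1]] := IH2 _ _ _ C2 w2 oks Bs R.
  exists (set_reg r1 31 1); split=> //; last exact: represents_tmp.
  have S2 := jump_reach r1 (inp (run c2 s)) oc oj.
  rewrite size_cat /= (_ : p + _ = p1 + size l1); last by rewrite Ep1; lia.
  by apply: (reach_trans S0 (reach_trans S1 S2 (leqnn _))); lia.
- set l := compile (p + 5) c.
  move=> /code_at_cons [o0 /code_at_cons [o1 /code_at_cons [o2 /code_at_cons [o3 /code_at_cons [o4]]]]].
  move=> /code_at_cat [C /code_at_cons [o5 /code_at_cons [o6 _]]].
  move=> /and3P [ltx nx wc] [leN okd] Bs R.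
  have Ep5 : p.+4.+1 = p + 5 by lia.
  rewrite Ep5 in C o5 o6.
  suff H N : forall r s, var s x = N -> okdown (ok eps B c) (run c) x N s ->
      bounded s -> represents r s ->
      exists r', [/\ reach P (Config p r (inp s)) ((N * (time eps c + 5) + 3) * W)
                   (Config (p + 7 + size l) r' (inp (down (run c) x N s))),
                 represents r' (down (run c) x N s) & bounded (down (run c) x N s)].
    have [r' [S' R' B']] := H _ r s erefl okd Bs R.
    exists r'; split=> //; rewrite size_cat /= (_ : p + _ = p + 7 + size l); last by lia.
    apply: (reach_trans S' (reach_refl _ _ 0)).
    by rewrite addn0 leq_mul2r leq_add2r leq_mul2r leN !orbT.
  elim: N {okd leN Bs R s r} => [|N IHN] r s Ex okd Bs R /=.
    have S0 := test_reach (inp s) o0 ltx R Bs; rewrite Ex /= in S0.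
    have S1 := jump_reach r (inp s) o1 o2.
    exists (set_reg r 31 1); split=> //; last exact: represents_tmp.
    by apply: (reach_trans S0 S1); lia.
  have S0 := test_reach (inp s) o0 ltx R Bs; rewrite Ex /= addn3 in S0.
  set r1 := set_reg r 31 1.
  have R1 : represents r1 s by apply: represents_tmp.
  have S1 : reach P (Config p.+3 r (inp s)) W (Config p.+4 r1 (inp s)).
    by apply: (reach_step o3) => //=; lia.
  set r2 := set_reg r1 x N.
  have S2 : reach P (Config p.+4 r1 (inp s)) W (Config (p + 5) r2 (inp s)).
    apply: (reach_step o4) => /=; last first.
      by rewrite -Ep5 R1.1 // Ex {2}/r1 /set_reg /= subn1.
    rewrite /word_cost mul2n -addnn R1.1 //.
    by apply: leq_add; apply: bitlen_le; [have := Bs.1 x ltx | rewrite /r1 /set_reg /=]; lia.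
  have BN : N <= B by have := Bs.1 x ltx; lia.
  have [oc okd'] := okd.
  have [r3 [S3 R3 B3]] := IH _ r2 (setv s x N) C wc oc (bounded_setv x Bs BN)
                           (represents_setv N R1 ltx).
  have S4 := jump_reach r3 (inp (run c (setv s x N))) o5 o6.
  (* The counter survives the body because [wf] forbids assigning to it. *)
  have Ex' : var (run c (setv s x N)) x = N.
    by rewrite (run_frame c _).1 //= /set_reg eqxx.
  have [r5 [S5 R5 B5]] := IHN (set_reg r3 31 1) _ Ex' okd' B3 (represents_tmp (t := 31) 1 R3 isT).
  exists r5; split=> //.
  apply: (reach_trans S0 (reach_trans S1 (reach_trans S2 (reach_trans S3
            (reach_trans S4 S5 (leqnn _)) (leqnn _)) (leqnn _)) (leqnn _))).
  by lia.
Qed.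

Lemma compile_answers c w : wf c -> ok eps B c (MkStore (fun=> 0) (fun _ _ => 0) w) ->
  exists2 t, t <= time eps c * W &
  answers (compile 0 c) w t (0 < var (run c (MkStore (fun=> 0) (fun _ _ => 0) w)) 0).
Proof.
move=> wc okc; set s0 := MkStore _ _ _ in okc *.
have C : code_at (compile 0 c) 0 (compile 0 c) by exists [::], [::]; rewrite cats0.
have [||r' [[t let_ H] R' _]] := @compile_correct _ c 0 (fun=> 0) s0 C wc okc; [by [] | by [] |].
exists t => //.
exists (Config (0 + size (compile 0 c)) r' (inp (run c s0))); last by rewrite /= R'.1.
by rewrite -[t]addn0; apply: H; apply: halts_stop.
Qed.

End Correct.

(** * The program *)

(* Variables: 0 answer, 1 n, 2 k, 3 n^2, 4 the constant 1, 5 position in the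
   adjacency matrix, 6 w, 7 u, 8 "w touches a marked vertex", 9 10 21 22
   scratch, 11 12 the first two elements of the fringe, 13 an unmarked vertex
   to be marked, 14 15 16 vertices of status 0, 1, 2, 17 word, 18 left,
   19 20 current power of 3 and digit, 23 seed, 24 initial word, 25 fuel, 26 the
   power of 3 reached so far, 27 its exponent, 28 the constant 0.  Vertices in
   11-16 are shifted by one, 0 standing for "none".
   Arrays: 0 adjacency matrix, 1 statuses, 2 powers of 3.
   Loop bounds: 0 n, 1 k, 2 n^2, 3 3^k, 4 4n+1. *)

Local Infix ";;" := CSeq (at level 61, right associativity).
Local Notation copy x y := (CSub x y 28).
Local Notation dec x := (CSub x x 4).
Local Notation status y v := (CConst 21 v ;; CPut 1 y 21).

(** Both scanning loops count down, so variable 5 walks the matrix backwards from its end and no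
    product is computed. Truncated subtraction recognises status 3: positive after taking away 2,
    zero after taking away 3. *)
Definition touch_cmd :=
  CLoop 7 0 (dec 5 ;; CGet 10 0 5 ;; CGet 9 1 7 ;;
    CIf 10 (CConst 21 2 ;; CSub 9 9 21 ;;
      CIf 9 (dec 9 ;; CIf 9 CSkip (CConst 8 1)) CSkip) CSkip).

(** As [w] decreases, the last value written is the smallest: 11 and 12 end as the first two
    elements of the fringe in increasing order. *)
Definition record_cmd :=
  CGet 9 1 6 ;; CAdd 22 6 4 ;;
  CIf 9
    (dec 9 ;; CIf 9
      (dec 9 ;; CIf 9 CSkip (copy 16 22 ;; CIf 8 (copy 13 22) CSkip))
      (copy 15 22))
    (copy 14 22 ;; CIf 8 (copy 12 11 ;; copy 11 22) CSkip).

Definition scan_init :=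
  copy 5 3 ;; CConst 11 0 ;; CConst 12 0 ;; CConst 13 0 ;; CConst 14 0 ;;
  CConst 15 0 ;; CConst 16 0 ;; copy 6 1.

Definition scan_loop := CLoop 6 0 ((CConst 8 0 ;; copy 7 1) ;; touch_cmd ;; record_cmd).

(** The comparison [q <= w] is tested as [0 < w + 1 - q]. Two rounds extract a ternary digit without
    division. *)
Definition trit_cmd :=
  CAdd 21 17 4 ;; CSub 21 21 19 ;; CIf 21 (CSub 17 17 19 ;; CAdd 20 20 4) CSkip.

Definition digit_cmd := dec 18 ;; CGet 19 2 18 ;; CConst 20 0 ;; trit_cmd ;; trit_cmd.

Definition branch_cmd :=
  CSub 22 11 4 ;;
  CIf 20
    (status 22 1 ;; CIf 15 CSkip
      (CIf 12 (CSub 22 12 4 ;; dec 20 ;; CIf 20 (status 22 1) (status 22 3)) CSkip))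
    (status 22 3).

Definition advance_loop :=
  CLoop 6 0 (CGet 9 1 6 ;;
    CIf 9 (dec 9 ;; CIf 9
      (dec 9 ;; CIf 9 (dec 9 ;; CIf 9 CSkip (status 6 4)) CSkip)
      (status 6 2)) CSkip).

Definition advance_cmd := copy 6 1 ;; advance_loop ;; (CSub 22 15 4 ;; status 22 3).

(** The sum of 15, 16 and 12 vanishes exactly when the three emptiness conditions of the forced move
    hold. *)
Definition decide_cmd :=
  CIf 13 (CSub 22 13 4 ;; status 22 3)
  (CIf 11
    ((CAdd 21 15 16 ;; CAdd 21 21 12) ;;
     CIf 21 (CIf 18 (digit_cmd ;; branch_cmd) CSkip) (CSub 22 11 4 ;; status 22 1))
    (CIf 16 CSkip (CIf 15 advance_cmd (CIf 14 CSkip (CConst 0 1))))).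

Definition micro_cmd := scan_init ;; scan_loop ;; decide_cmd.

Definition reset_loop := CLoop 6 0 (status 6 0).

Definition simulate_cmd :=
  copy 6 1 ;; reset_loop ;;
  (status 23 3 ;; copy 17 24 ;; copy 18 2 ;;
   CAdd 25 1 1 ;; CAdd 25 25 25 ;; CAdd 25 25 4) ;;
  CLoop 25 4 micro_cmd.

Definition search_cmd := copy 23 1 ;; CLoop 23 0 (copy 24 26 ;; CLoop 24 3 simulate_cmd).

Definition square_loop := CLoop 6 0 (CAdd 3 3 1).
Definition read_loop := CLoop 6 2 (CRead 10 ;; CPut 0 5 10 ;; CAdd 5 5 4).
Definition power_loop := CLoop 6 1 (CPut 2 27 26 ;; CAdd 27 27 4 ;; CAdd 9 26 26 ;; CAdd 26 26 9).

Definition setup_cmd :=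
  (CConst 4 1 ;; CRead 1 ;; CRead 2 ;; copy 6 1) ;; square_loop ;;
  copy 6 3 ;; read_loop ;; (CConst 26 1 ;; copy 6 2) ;; power_loop.

Definition solver := setup_cmd ;; search_cmd.

Lemma solver_wf : wf solver.
Proof. by []. Qed.

(** The invariants do not control array cells from [n] on; cutting them off lets the status array be
    compared with [stat] by an equality of functions. *)
Definition clip n (f : nat -> nat) := fun w => if w < n then f w else 0.

Lemma clip_set n f x v : x < n -> clip n (set_reg f x v) = set_reg (clip n f) x v.
Proof.
move=> ltx; apply: functional_extensionality => w; rewrite /clip /set_reg.
by case: (w =P x) => [->|//]; rewrite ltx.
Qed.

Definition code (l : seq nat) := if l is x :: _ then x.+1 else 0.

(** * The program simulates the search *)

Section Verify.
Variables (n k : nat) (a : rel nat).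

Definition loop_bound b := nth 0 [:: n; k; n * n; 3 ^ k; (4 * n).+1] b.
Definition value_bound := n * n + 4 * n + 3 * 3 ^ k + k + 10.
Local Notation wp := (wpre loop_bound value_bound).

Record env s : Prop := Env {
  env_n : var s 1 = n;
  env_k : var s 2 = k;
  env_nn : var s 3 = n * n;
  env_one : var s 4 = 1;
  env_zero : var s 28 = 0;
  env_adj : forall w u, w < n -> u < n -> (0 < arr s 0 (w * n + u)) = a w u;
  env_pow : forall i, i < k -> arr s 2 i = 3 ^ i }.

Lemma env_frame xs js s s' : frame xs js s s' ->
  all [predC xs] [:: 1; 2; 3; 4; 28] -> all [predC js] [:: 0; 2] -> env s -> env s'.
Proof.
move=> [Fv Fa] /and5P [x1 x2 x3 x4 /andP [x5 _]] /and3P [j1 j2 _] [e1 e2 e3 e4 e5 e6 e7].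
split; rewrite ?Fv //; [move=> w u ltw ltu | move=> i lti]; rewrite Fa //; auto.
Qed.

Lemma env_setv s x v : x \notin [:: 1; 2; 3; 4; 28] -> env s -> env (setv s x v).
Proof.
move=> nx; apply: (@env_frame [:: x] [::]); last by [].
  by apply: frame_setv; rewrite mem_head.
by apply/allP => y iny /=; rewrite inE; apply: contraNneq nx => <-.
Qed.

Lemma touch_ok s w : env s -> w < n -> var s 5 = w.+1 * n -> var s 7 = n -> var s 8 = 0 ->
  wp touch_cmd (fun s' => var s' 5 = w * n /\
    (0 < var s' 8) = touches n a (clip n (arr s 1)) w) s.
Proof.
move=> E ltw E5 E7 E8; set st := clip n _.
pose Inv j s' := var s' 5 = w * n + j /\
  (0 < var s' 8) = has (fun u => (st u == 3) && a w u) (iota j (n - j)).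
apply: (@wp_loop _ _ _ _ _ Inv).
- by rewrite E7.
- by rewrite /Inv E7 E5 E8 subnn /= mulSnr.
- move=> j s'; rewrite E7 => ltj F [I5 I8].
  have E' := env_frame F isT isT E.
  have B2 : 2 <= value_bound by rewrite /value_bound; lia.
  have B1 : 1 <= value_bound := ltnW B2.
  have Ea : arr s' 1 = arr s 1 by apply: F.2.
  have Est : st j = arr s' 1 j by rewrite /st /clip ltj Ea.
  have := env_adj E' ltw ltj.
  rewrite /wpre /Inv /= /set_reg /= I5 (env_one E') -addnBA // subSS subn0 -(subnSK ltj) /= Est => Ez.
  rewrite -Ez; case: (0 < arr s' 0 _) => /=; last first.
    by rewrite andbF /=.
  have -> : (0 < arr s' 1 j - 2) = (2 < arr s' 1 j) by rewrite subn_gt0.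
  case: ifP => lt2 /=; last first.
    by rewrite (_ : (_ == 3) = false) //; lia.
  have -> : (0 < arr s' 1 j - 2 - 1) = (3 < arr s' 1 j) by lia.
  case: ifP => lt3 /=; first by rewrite (_ : (_ == 3) = false) //; lia.
  by rewrite (_ : (_ == 3) = true) //; lia.
- by move=> s' F [I5 I8]; split; rewrite ?I5 ?addn0 // I8 subn0.
Qed.

Lemma iota_cons j : j < n -> iota j (n - j) = j :: iota j.+1 (n - j.+1).
Proof. by move=> ltj; rewrite -(subnSK ltj). Qed.

(** Counting down leaves the [j] smallest vertices unscanned; at [j = 0] the lists are those that
    [micro] inspects. *)
Record scanned st s j : Prop := Scanned {
  sc_pos : var s 5 = j * n;
  sc_u1 : var s 11 = code [seq w <- iota j (n - j) | (st w == 0) && touches n a st w];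
  sc_u2 : var s 12 = code (behead [seq w <- iota j (n - j) | (st w == 0) && touches n a st w]);
  sc_x2 : var s 13 = code [seq w <- iota j (n - j) | (st w == 2) && touches n a st w];
  sc_h0 : var s 14 = code [seq w <- iota j (n - j) | st w == 0];
  sc_h1 : var s 15 = code [seq w <- iota j (n - j) | st w == 1];
  sc_h2 : var s 16 = code [seq w <- iota j (n - j) | st w == 2] }.

Lemma record_ok st s j : env s -> j < n -> st = clip n (arr s 1) -> var s 6 = j ->
  (0 < var s 8) = touches n a st j -> var s 5 = j * n ->
  scanned st (setv s 5 (j.+1 * n)) j.+1 ->
  wp record_cmd (fun s' => scanned st s' j) s.
Proof.
move=> E ltj Est E6 E8 E5 [_ s1 s2 s3 s4 s5 s6].
rewrite /= /set_reg /= in s1 s2 s3 s4 s5 s6.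
have Ej : st j = arr s 1 j by rewrite Est /clip ltj.
have ltB : j + 1 <= value_bound by rewrite /value_bound; lia.
rewrite /wpre /= /set_reg /= E6 (env_one E) (env_zero E) -Ej.
have gtE m : (0 < st j - m) = (m < st j) by rewrite subn_gt0.
case: (posnP (st j)) => [Z|nZ] /=.
  case: (boolP (0 < var s 8)) => H8 /=; rewrite E8 in H8;
    split=> //; split; rewrite /= /set_reg /= ?E5 // iota_cons //= Z /= ?H8 ?(negbTE H8) //=
      ?s1 ?s2 ?s3 ?s4 ?s5 ?s6 ?(env_zero E) ?subn0 ?addn1 //.
rewrite (gtE 1); case: ifP => n1 /=; last first.
  have Z : st j = 1 by lia.
  split=> //; split; rewrite /= /set_reg /= ?E5 // iota_cons //= Z /=
      ?s1 ?s2 ?s3 ?s4 ?s5 ?s6 ?(env_zero E) ?subn0 ?addn1 //.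
rewrite -subnDA (gtE 2); case: ifP => n2 /=; last first.
  have Z : st j = 2 by lia.
  case: (boolP (0 < var s 8)) => H8 /=; rewrite E8 in H8;
    split=> //; split; rewrite /= /set_reg /= ?E5 // iota_cons //= Z /= ?H8 ?(negbTE H8) //=
      ?s1 ?s2 ?s3 ?s4 ?s5 ?s6 ?(env_zero E) ?subn0 ?addn1 //.
have [Z0 Z1 Z2] : [/\ st j <> 0, st j <> 1 & st j <> 2] by split; lia.
split=> //; split; rewrite /= /set_reg /= ?E5 // iota_cons //=
  ?(introF eqP Z0) ?(introF eqP Z1) ?(introF eqP Z2) /=
      ?s1 ?s2 ?s3 ?s4 ?s5 ?s6 ?(env_zero E) ?subn0 ?addn1 //.
Qed.

Lemma scan_ok s : env s ->
  wp (scan_init ;; scan_loop) (fun s' => scanned (clip n (arr s 1)) s' 0) s.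
Proof.
move=> E; set st := clip n _; apply: wp_seq; split=> //.
set s1 := run scan_init s.
have F1 : frame (assigned scan_init) (stored scan_init) s s1 by apply: run_frame.
have E1 : env s1 by apply: env_frame F1 _ _ E.
have Ea1 : arr s1 1 = arr s 1 by apply: F1.2.
have n1 : var s1 6 = n by rewrite /s1 /= /set_reg /= (env_n E) (env_zero E) subn0.
apply: (@wp_loop _ _ _ _ _ (fun j s' => scanned st s' j)).
- by rewrite n1.
- rewrite n1 /s1; split; rewrite /= /set_reg /= ?subnn //.
  by rewrite (env_nn E) (env_zero E) subn0.
- move=> j s'; rewrite n1 => ltj F I; have E' : env s' by apply: env_frame F _ _ E1.
  have Ea' : arr s' 1 = arr s 1 by rewrite F.2.
  apply: wp_seq; split=> //.
  set s2 := run _ _.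
  have F2 : frame [:: 6; 7; 8] [::] s' s2.
    by split=> // x; rewrite !inE !negb_or => /and3P [x6 x7 x8];
       rewrite /= /set_reg (negbTE x6) (negbTE x7) (negbTE x8).
  have E2 : env s2 by apply: env_frame F2 _ _ E'.
  apply: wp_seq; apply: wp_weak; last apply: (@touch_ok s2 j) => //.
  + move=> s3 F3 [E5 E8].
    have Ea3 : arr s3 1 = arr s 1 by rewrite F3.2 // F2.2.
    apply: record_ok => //.
    * by apply: env_frame F3 _ _ E2.
    * by rewrite Ea3.
    * by rewrite F3.1.
    * by rewrite E8 F2.2 // Ea'.
    * by case: I => *; split; rewrite /= /set_reg //= F3.1 // F2.1.
  + by rewrite F2.1 // (sc_pos I).
  + by rewrite /s2 /= /set_reg /= (env_n E') (env_zero E') subn0.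
- by [].
Qed.

(** [m_word_lt] makes the leading quotient a digit below 3, so that two subtractions suffice;
    [m_left_le] keeps the look-up of its power inside the table. *)
Record matches s q : Prop := Matches {
  m_stat : clip n (arr s 1) = stat q;
  m_left : var s 18 = left q;
  m_word : var s 17 = word q;
  m_acc : (0 < var s 0) = acc q;
  m_word_lt : word q < 3 ^ left q;
  m_left_le : left q <= k }.

Lemma trit_ok s w q d : var s 4 = 1 -> var s 17 = w -> var s 19 = q -> var s 20 = d ->
  w + 1 <= value_bound -> d + 1 <= value_bound ->
  wp trit_cmd (fun s' => var s' 17 = (if q <= w then w - q else w) /\
                         var s' 20 = d + (q <= w)) s.
Proof.
move=> E4 E17 E19 E20 Bw Bd.
rewrite /wpre /= /set_reg /= E17 E4 E19.
have -> : (0 < w + 1 - q) = (q <= w) by lia.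
case: ifP => _ /=; rewrite /set_reg /= ?E17 ?E19 ?E20 ?E4 ?addn0; by do !split.
Qed.

Lemma digit_ok s l w : env s -> var s 18 = l.+1 -> l < k -> var s 17 = w -> w < 3 ^ l.+1 ->
  wp digit_cmd (fun s' => [/\ var s' 18 = l, var s' 17 = w %% 3 ^ l & var s' 20 = w %/ 3 ^ l]) s.
Proof.
move=> E E18 ltl E17 ltw.
have pow_k : 3 ^ l.+1 <= 3 ^ k by rewrite leq_pexp2l.
have q0 : 0 < 3 ^ l by rewrite expn_gt0.
have B3 : w + 2 <= value_bound by rewrite /value_bound; lia.
rewrite expnS in ltw.
have divmod d r : w = d * 3 ^ l + r -> r < 3 ^ l -> w %% 3 ^ l = r /\ w %/ 3 ^ l = d.
  by move=> -> ltr; rewrite modnMDl modn_small // divnMDl // divn_small // addn0.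
have Epow := env_pow E ltl; have E4 := env_one E.
set q := 3 ^ l in ltw q0 divmod Epow *.
rewrite /digit_cmd; apply: wp_seq; split=> //; apply: wp_seq; split=> //.
apply: wp_seq; split=> //.
set s0 := run (CConst 20 0) _.
have [E18' E19' E17'] : [/\ var s0 18 = l, var s0 19 = q & var s0 17 = w].
  by rewrite /s0 /= /set_reg /= E18 E4 subSS subn0 Epow E17.
apply: wp_seq; apply: wp_weak; last apply: (@trit_ok s0 w q 0) => //; [|lia..].
move=> s1 F1 [H17 H20].
apply: wp_weak; last apply: (@trit_ok s1 _ q _ _ H17 _ H20) => //.
- move=> s2 F2 [G17 G20]; rewrite F2.1 // F1.1 // G17 G20 E18'.
  case: (leqP q w) => cmp1; last first.
    rewrite leqNgt cmp1 /=.
    by have [-> ->] : w %% q = w /\ w %/ q = 0 by apply: divmod; lia.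
  case: (leqP q (w - q)) => cmp2.
    by have [-> ->] : w %% q = w - q - q /\ w %/ q = 2 by apply: divmod; lia.
  by have [-> ->] : w %% q = w - q /\ w %/ q = 1 by apply: divmod; lia.
- by rewrite F1.1.
- by rewrite F1.1.
- by case: ifP => _; lia.
- by case: (q <= w); lia.
Qed.

Lemma branch_ok s st u r d : env s -> st = clip n (arr s 1) ->
  var s 11 = u.+1 -> u < n -> var s 12 = code r -> {in r, forall w, w < n} ->
  var s 15 = code (having n st 1) -> var s 20 = d ->
  wp branch_cmd (fun s' => clip n (arr s' 1) = branch n st u r d) s.
Proof.
move=> E Est E11 ltu E12 ltr E15 E20.
have B4 : 3 <= value_bound by rewrite /value_bound; lia.
have B1 : 1 <= value_bound by lia.
rewrite /wpre /= /set_reg /= E20 E11 (env_one E) !subn1 /= E15 E12 /branch.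
case: (posnP d) => [_|d0] /=; first by rewrite clip_set // -Est.
case: (having n st 1) => [|y r1] /=; last by rewrite clip_set // -Est.
case: r ltr {E12} => [|u2 r] ltr /=; first by rewrite clip_set // -Est.
have ltu2 : u2 < n by apply: ltr; rewrite mem_head.
have -> : (0 < d.-1) = (d != 1) by lia.
by case: eqP => _ /=; rewrite !clip_set // -Est.
Qed.

Lemma advance_ok s y : env s -> var s 15 = y.+1 -> y < n ->
  wp advance_cmd (fun s' => clip n (arr s' 1) = advance (clip n (arr s 1)) y) s.
Proof.
move=> E E15 lty; apply: wp_seq; split=> //; set s1 := run _ s.
have E1 : env s1 by apply: env_setv.
have n1 : var s1 6 = n by rewrite /= /set_reg /= (env_n E) (env_zero E) subn0.
have B4 : 4 <= value_bound by rewrite /value_bound; lia.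
have [B3 B2] : 3 <= value_bound /\ 2 <= value_bound by lia.
pose adv w := if arr s 1 w == 3 then 4 else if arr s 1 w == 1 then 2 else arr s 1 w.
pose Inv j s' := forall w, arr s' 1 w = if (j <= w) && (w < n) then adv w else arr s 1 w.
apply: wp_seq; apply: (@wp_loop _ _ _ _ _ Inv).
- by rewrite n1.
- by move=> w; rewrite n1 /=; case: ltngtP.
- move=> j s'; rewrite n1 => ltj F I; have E' : env s' by apply: env_frame F _ _ E1.
  have step v : v = adv j -> forall w, set_reg (arr s' 1) j v w =
      if (j <= w) && (w < n) then adv w else arr s 1 w.
    move=> -> w; rewrite /set_reg; case: (w =P j) => [->|nw]; first by rewrite leqnn ltj.
    by rewrite I; congr (if _ && _ then _ else _); lia.
  have same : arr s 1 j = adv j -> forall w, arr s' 1 w =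
      if (j <= w) && (w < n) then adv w else arr s 1 w.
    move=> Ej w; rewrite I; case: (ltngtP w j) => //= ->; by rewrite ltj.
  have Ej : arr s' 1 j = arr s 1 j by rewrite I ltnn.
  rewrite /wpre /Inv /= /set_reg /= Ej (env_one E').
  case: (posnP (arr s 1 j)) => [Z|nZ] /=.
    by split=> //; apply: same; rewrite /adv Z.
  rewrite subn_gt0; case: ifP => n2 /=; last first.
    split=> //; apply: step; rewrite /adv; have -> : arr s 1 j = 1 by lia.
    by [].
  rewrite -subnDA subn_gt0; case: ifP => n3 /=; last first.
    split=> //; apply: same; rewrite /adv; have -> : arr s 1 j = 2 by lia.
    by [].
  rewrite -subnDA subn_gt0; case: ifP => n4 /=.
    split=> //; apply: same; rewrite /adv.
    by rewrite (_ : (_ == 3) = false) 1?(_ : (_ == 1) = false) //; lia.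
  split=> //; apply: step; rewrite /adv; have -> : arr s 1 j = 3 by lia.
  by [].
- move=> s' F I; have E' : env s' by apply: env_frame F _ _ E1.
  rewrite /wpre /= /set_reg /= (env_one E') F.1 // /s1 /= /set_reg /= E15 subn1 /=.
  split=> //; rewrite (clip_set _ _ lty) /advance; congr (set_reg _ y 3).
  apply: functional_extensionality => w; rewrite /clip I /=.
  by case: ltnP.
Qed.

Lemma code_gt0 l : (0 < code l) = ~~ nilp l.
Proof. by case: l. Qed.

Lemma decide_ok s q : env s -> matches s q -> scanned (stat q) s 0 ->
  wp decide_cmd (fun s' => matches s' (micro n a q)) s.
Proof.
case: q => st l w b E [/= mst ml mw ma mlt mle] [_ s1 s2 s3 s4 s5 s6].
rewrite subn0 -/(fringe n a st 0) in s1; rewrite subn0 -/(fringe n a st 0) in s2.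
rewrite subn0 -/(fringe n a st 2) in s3; rewrite subn0 -/(having n st 0) in s4.
rewrite subn0 -/(having n st 1) in s5; rewrite subn0 -/(having n st 2) in s6.
have B3 : 3 <= value_bound by rewrite /value_bound; lia.
have B1 : 1 <= value_bound by lia.
have code_le P : code [seq x <- iota 0 n | P x] <= n.
  case El: [seq x <- _ | _] => [//|x r] /=.
  have: x \in [seq x <- iota 0 n | P x] by rewrite El mem_head.
  by rewrite mem_filter mem_iota => /andP [_].
rewrite /decide_cmd /micro.
apply: wp_if; rewrite s3; case E2: (fringe n a st 2) => [|x r2] /=; last first.
  have [ltx _ _] := fringe_cons E2.
  rewrite /wpre /= /set_reg /= s3 E2 (env_one E) subn1 /=; split=> //.
  by split=> //=; rewrite clip_set // mst.
apply: wp_if; rewrite s1; case E0: (fringe n a st 0) => [|u r] /=; last first.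
  have [ltu Eu _] := fringe_cons E0.
  apply: wp_seq; split.
    rewrite /= /set_reg /= s5 s6 s2.
    have := code_le (fun w => st w == 1); have := code_le (fun w => st w == 2).
    have := code_le (fun w => (st w == 0) && touches n a st w).
    rewrite -/(having n st 1) -/(having n st 2) -/(fringe n a st 0).
    have : code (behead (fringe n a st 0)) <= n.
      case Er: (behead _) => [//|y r'] /=.
      have: y \in fringe n a st 0 by apply: mem_behead; rewrite Er mem_head.
      by rewrite mem_filter mem_iota => /andP [_].
    rewrite /value_bound; lia.
  set s' := run _ s.
  have F' : frame [:: 21] [::] s s'.
    by split=> // y; rewrite !inE => ny; rewrite /= /set_reg (negbTE ny).
  have E' : env s' by apply: env_frame F' _ _ E.
  apply: wp_if.
  have -> : (0 < var s' 21) = ~~ (nilp (having n st 1) && nilp (having n st 2) && nilp r).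
    rewrite /s' /= /set_reg /= s5 s6 s2 E0 /= !addn_gt0 !code_gt0.
    by rewrite !negb_and.
  case: (_ && nilp r) => /=.
    rewrite /wpre /= /set_reg /= -/(set_reg st u 1) (env_one E) s1 E0 subn1 /=.
    by split=> //; split=> //=; rewrite clip_set // mst.
  apply: wp_if; rewrite F'.1 // ml; case: l ml mlt mle => [|l] ml mlt mle /=.
    by split.
  apply: wp_seq; apply: wp_weak; last apply: (@digit_ok s' l w) => //.
  - move=> s'' F'' [E18 E17 E20].
    have E'' : env s'' by apply: env_frame F'' _ _ E'.
    have Ea : arr s'' 1 = arr s 1 by rewrite F''.2.
    apply: wp_weak; last apply: (@branch_ok s'' st u r (w %/ 3 ^ l)) => //.
    + move=> s3' F3 Est; split=> //=.
      * by rewrite F3.1.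
      * by rewrite F3.1.
      * by rewrite F3.1 // F''.1 // F'.1.
      * by rewrite ltn_mod expn_gt0.
      * exact: ltnW.
    + by rewrite Ea.
    + by rewrite F''.1 // F'.1 // s1 E0.
    + by rewrite F''.1 // F'.1 // s2 E0.
    + move=> z inz; have: z \in fringe n a st 0 by rewrite E0 inE inz orbT.
      by rewrite mem_filter mem_iota => /andP [_].
    + by rewrite F''.1 // F'.1 // s5.
apply: wp_if; rewrite s6; case H2: (having n st 2) => [|y2 r2] /=; last by split.
apply: wp_if; rewrite s5; case H1: (having n st 1) => [|y1 r1] /=; last first.
  have [lty Ey] := having_cons H1.
  apply: wp_weak; last apply: (@advance_ok s y1) => //.
    by move=> s' F' Est; split=> //=; rewrite ?Est ?mst // F'.1.
  by rewrite s5 H1.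
apply: wp_if; rewrite s4; case H0: (having n st 0) => [|y0 r0] /=; last by split.
by split=> //; split.
Qed.

Lemma micro_ok s q : env s -> matches s q ->
  wp micro_cmd (fun s' => matches s' (micro n a q)) s.
Proof.
move=> E M; rewrite /micro_cmd.
have [[o1 o2] S] := scan_ok E.
apply: wp_seq; split=> //; apply: wp_seq; split=> //.
set s2 := run scan_loop _.
have F1 := run_frame scan_init s; have F2 := run_frame scan_loop (run scan_init s).
apply: decide_ok.
- by apply: env_frame F2 _ _ (env_frame F1 _ _ E).
- case: M => m1 m2 m3 m4 m5 m6; split=> //.
  + by rewrite F2.2 // F1.2.
  + by rewrite F2.1 // F1.1.
  + by rewrite F2.1 // F1.1.
  + by rewrite F2.1 // F1.1.
- by rewrite -(m_stat M).
Qed.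

(** Variable 0 is never cleared between simulations, so it collects a disjunction; this is harmless
    since [micro] never consults [acc]. *)
Definition with_acc b q := Sim (stat q) (left q) (word q) (b || acc q).

Lemma micro_with_acc b q : micro n a (with_acc b q) = with_acc b (micro n a q).
Proof.
case: q => st l w c; rewrite /with_acc /=.
case: (fringe n a st 2) => [|x r2] //=; case: (fringe n a st 0) => [|u r] /=.
  by do ![case: (having _ _ _) => [|? ?] //=]; rewrite orbT.
by case: ifP => // _; case: l.
Qed.

Lemma iter_with_acc f b q : iter f (micro n a) (with_acc b q) = with_acc b (iter f (micro n a) q).
Proof. by elim: f => //= f ->; rewrite micro_with_acc. Qed.

Lemma simulate_ok s v w : env s -> var s 23 = v -> v < n -> var s 24 = w -> w < 3 ^ k ->
  wp simulate_cmd (fun s' => (0 < var s' 0) = (0 < var s 0) || accepts n a v k w) s.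
Proof.
move=> E E23 ltv E24 ltw; rewrite /simulate_cmd.
have Bn : 4 * n + 3 <= value_bound by rewrite /value_bound; lia.
apply: wp_seq; split=> //; set s1 := run _ s.
have E1 : env s1 by apply: env_setv.
have n1 : var s1 6 = n by rewrite /= /set_reg /= (env_n E) (env_zero E) subn0.
pose Inv j s' := forall w, j <= w < n -> arr s' 1 w = 0.
apply: wp_seq; apply: (@wp_loop _ _ _ _ _ Inv).
- by rewrite n1.
- by move=> x; rewrite n1; lia.
- move=> j s' ltj F I; split=> //= x Hx; rewrite /= /set_reg /=.
  by case: (x =P j) => // nx; apply: I; lia.
move=> s2 F2 I2; have E2 : env s2 by apply: env_frame F2 _ _ E1.
apply: wp_seq; split.
  by rewrite /= /set_reg /= (env_n E2) (env_one E2); do !split=> //; lia.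
set s3 := run _ s2.
have F3 : frame [:: 17; 18; 21; 25] [:: 1] s2 s3.
  split=> [x|j]; rewrite !inE ?negb_or.
    by case/and4P=> x1 x2 x3 x4; rewrite /= /set_reg (negbTE x1) (negbTE x2) (negbTE x3) (negbTE x4).
  by rewrite /= => /negbTE ->.
have E3 : env s3 by apply: env_frame F3 _ _ E2.
have n3 : var s3 25 = (4 * n).+1 by rewrite /= /set_reg /= (env_n E2) (env_one E2); lia.
pose q0 := with_acc (0 < var s 0) (start v k w).
have M3 : matches s3 q0.
  have V0 x : x \notin [:: 6; 17; 18; 21; 25] -> var s3 x = var s x.
    rewrite !inE !negb_or => /and5P [x0 x1 x2 x3 x4].
    rewrite F3.1; last by rewrite !inE !negb_or x1 x2 x3 x4.
    rewrite F2.1; last by rewrite !inE !negb_or x0 x3.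
    by rewrite /= /set_reg (negbTE x0).
  have v2 : var s2 23 = v by rewrite F2.1.
  have A3 : arr s3 1 = set_reg (arr s2 1) (var s2 23) 3 by [].
  split.
  - rewrite A3 v2 clip_set //; congr (set_reg _ v 3).
    apply: functional_extensionality => x; rewrite /clip; case: ifP => // ltx.
    by rewrite I2 // ltx.
  - by rewrite /= /set_reg /= (env_k E2) (env_zero E2) subn0.
  - by rewrite /= /set_reg /= (env_zero E2) subn0 F2.1.
  - by rewrite /= orbF -(V0 0).
  - by [].
  - by [].
apply: (@wp_loop _ _ _ _ _ (fun j s' => matches s' (iter ((4 * n).+1 - j) (micro n a) q0))).
- by rewrite n3.
- by rewrite n3 subnn.
- move=> j s'; rewrite n3 => ltj F M; have E' : env s' by apply: env_frame F _ _ E3.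
  rewrite (_ : (4 * n).+1 - j = ((4 * n).+1 - j.+1).+1); last by lia.
  apply: micro_ok; first exact: env_setv.
  by case: M => *; split.
- by move=> s' F M; rewrite (m_acc M) subn0 iter_with_acc.
Qed.

Definition search_result := has (fun v => has (accepts n a v k) (iota 0 (3 ^ k))) (iota 0 n).

Lemma search_ok s : env s -> var s 26 = 3 ^ k -> var s 0 = 0 ->
  wp search_cmd (fun s' => (0 < var s' 0) = search_result) s.
Proof.
move=> E E26 E0; rewrite /search_cmd.
apply: wp_seq; split=> //; set s1 := run _ s.
have E1 : env s1 by apply: env_setv.
have n1 : var s1 23 = n by rewrite /= /set_reg /= (env_n E) (env_zero E) subn0.
apply: (@wp_loop _ _ _ _ _ (fun j s' => (0 < var s' 0) =
  has (fun v => has (accepts n a v k) (iota 0 (3 ^ k))) (iota j (n - j)))).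
- by rewrite n1.
- by rewrite n1 subnn /= /set_reg /= E0.
- move=> v s'; rewrite n1 => ltv F I; have E' : env s' by apply: env_frame F _ _ E1.
  apply: wp_seq; split=> //; set s2 := run _ _.
  have E2 : env s2 by do 2![apply: env_setv => //].
  have n2 : var s2 24 = 3 ^ k.
    by rewrite /= /set_reg /= (env_zero E') subn0 F.1 //= /set_reg /= E26.
  apply: (@wp_loop _ _ _ _ _ (fun j s'' => (0 < var s'' 0) =
    (0 < var s' 0) || has (accepts n a v k) (iota j (3 ^ k - j)))).
  + by rewrite n2.
  + by rewrite n2 subnn /= orbF.
  + move=> w s''; rewrite n2 => ltw F2 I2; have E'' : env s'' by apply: env_frame F2 _ _ E2.
    apply: wp_weak; last apply: (@simulate_ok _ v w) => //.
    * move=> s3 F3 ->; rewrite [var _ 0]/= /set_reg /= I2 -(subnSK ltw) /= orbAC.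
      by rewrite -orbA.
    * exact: env_setv.
    * by rewrite /= /set_reg /= F2.1.
  + by move=> s'' F2 ->; rewrite I subn0 (iota_cons ltv) /= orbC.
- by move=> s' F ->; rewrite subn0.
Qed.

End Verify.

Lemma nth_allpairs (S T : Type) (f : S -> T -> nat) x0 y0 s t i j :
  i < size s -> j < size t ->
  nth 0 [seq f x y | x <- s, y <- t] (i * size t + j) = f (nth x0 s i) (nth y0 t j).
Proof.
elim: s i => // x s IH [|i] /= lti ltj; rewrite nth_cat size_map.
  by rewrite mul0n add0n ltj (nth_map y0).
rewrite mulSn -addnA ltnNge leq_addr /= addKn; exact: IH.
Qed.

Section Setup.
Variables (n k : nat) (a : rel nat) (l : seq nat).
Hypothesis size_l : size l = n * n.
Hypothesis l_le1 : all (fun v => v <= 1) l.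
Hypothesis l_adj : forall w u, w < n -> u < n -> (0 < nth 0 l (w * n + u)) = a w u.

Local Notation wp := (wpre (loop_bound n k) (value_bound n k)).

Lemma setup_ok :
  wp setup_cmd (fun s => [/\ env n k a s, var s 26 = 3 ^ k & var s 0 = 0])
    (MkStore (fun=> 0) (fun _ _ => 0) (n :: k :: l)).
Proof.
have Bn : n * n + 4 * n + k + 10 <= value_bound n k by rewrite /value_bound; lia.
have Bk : 3 * 3 ^ k + k <= value_bound n k by rewrite /value_bound; lia.
set s0 := MkStore _ _ _; rewrite /setup_cmd.
apply: wp_seq; split.
  by rewrite /= /set_reg /=; do !split=> //; lia.
set s1 := run _ s0.
pose fixed s := [/\ var s 0 = 0, var s 1 = n, var s 2 = k, var s 4 = 1 & var s 28 = 0].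
have V1 : fixed s1 by [].
have fixed_frame xs js s s' : frame xs js s s' -> all [predC xs] [:: 0; 1; 2; 4; 28] ->
    fixed s -> fixed s'.
  move=> [Fv _] /and5P [x1 x2 x3 x4 /andP [x5 _]] [f1 f2 f3 f4 f5].
  by rewrite /fixed !Fv.
have I1 : inp s1 = l by [].
have [n1 z3 z5 z27] : [/\ var s1 6 = n, var s1 3 = 0, var s1 5 = 0 & var s1 27 = 0].
  by rewrite /= /set_reg /= subn0.
apply: wp_seq; apply: (@wp_loop _ _ _ _ _ (fun j s => var s 3 = (n - j) * n /\ inp s = l)).
- by rewrite n1.
- by rewrite n1 subnn z3.
- move=> j s; rewrite n1 => ltj F [E3 Ei].
  have [f1 f2 f3 f4 f5] := fixed_frame _ _ _ _ F isT V1.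
  have Ej : n - j = (n - j.+1).+1 by lia.
  rewrite /wpre /= /set_reg /= E3 f2 Ej mulSnr; split=> //.
  have := leq_mul2r n (n - j.+1).+1 n; rewrite mulSnr; lia.
move=> s2 F2; rewrite subn0 => -[nn2 I2].
have V2 := fixed_frame _ _ _ _ F2 isT V1.
apply: wp_seq; split=> //; set s3 := run _ s2.
have V3 : fixed s3 by [].
have n3 : var s3 6 = n * n by case: V2 => f1 f2 f3 f4 f5; rewrite /= /set_reg /= nn2 f5 subn0.
pose Inv j s := [/\ var s 5 = n * n - j, inp s = drop (n * n - j) l &
  forall i, i < n * n - j -> arr s 0 i = nth 0 l i].
have z5' : var s3 5 = 0 by rewrite /= /set_reg /= F2.1.
apply: wp_seq; apply: (@wp_loop _ _ _ _ _ Inv).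
- by rewrite n3.
- by rewrite n3 /Inv subnn drop0 z5'.
- move=> j s; rewrite n3 => ltj F [E5 Ei Ea].
  have [f1 f2 f3 f4 f5] := fixed_frame _ _ _ _ F isT V3.
  have Ej : n * n - j = (n * n - j.+1).+1 by lia.
  have ltl : n * n - j.+1 < size l by rewrite size_l; lia.
  have le1 : nth 0 l (n * n - j.+1) <= 1 by apply: (all_nthP 0 l_le1).
  rewrite /wpre /Inv /= /set_reg /= Ei E5 f4 (drop_nth 0 ltl) Ej /=.
  do !split=> //; rewrite ?addn1 //; try by lia.
  move=> i lti; case: (i =P _) => [->//|ni]; apply: Ea; lia.
move=> s4 F4; rewrite /Inv subn0 => -[_ _ A4].
have V4 := fixed_frame _ _ _ _ F4 isT V3.
apply: wp_seq; split; first by split=> //=; lia.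
set s5 := run _ s4.
have V5 : fixed s5 by [].
have n5 : var s5 6 = k by case: V4 => f1 f2 f3 f4 f5; rewrite /= /set_reg /= f3 f5 subn0.
pose Inv' j s := [/\ var s 27 = k - j, var s 26 = 3 ^ (k - j) &
  forall i, i < k - j -> arr s 2 i = 3 ^ i].
apply: (@wp_loop _ _ _ _ _ Inv').
- by rewrite n5.
- rewrite n5 /Inv' subnn; split=> //; rewrite /= /set_reg /= F4.1 //= /set_reg /= F2.1 //.
- move=> j s; rewrite n5 => ltj F [E27 E26 Ea].
  have [f1 f2 f3 f4 f5] := fixed_frame _ _ _ _ F isT V5.
  have Ej : k - j = (k - j.+1).+1 by lia.
  have pk : 3 ^ (k - j.+1) <= 3 ^ k by rewrite leq_pexp2l //; lia.
  rewrite /wpre /Inv' /= /set_reg /= E27 E26 f4 Ej expnS.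
  do !split=> //; try by lia.
  move=> i lti; case: (i =P _) => [->//|ni]; apply: Ea; lia.
- move=> s6 F6; rewrite /Inv' subn0 => -[_ E26 Ep].
  have [f1 f2 f3 f4 f5] := fixed_frame _ _ _ _ F6 isT V5.
  split=> //; split=> //.
  + rewrite F6.1 //= /set_reg /= F4.1 //=.
  + move=> w u ltw ltu; rewrite F6.2 //= A4 ?l_adj //.
    by have := leq_mul2r n w.+1 n; rewrite ltw orbT mulSnr; lia.
Qed.

Lemma solver_ok :
  wp solver (fun s => (0 < var s 0) = search_result n k a)
    (MkStore (fun=> 0) (fun _ _ => 0) (n :: k :: l)).
Proof.
apply: wp_seq; have [o [E E26 E0]] := setup_ok; split=> //.
exact: search_ok.
Qed.

End Setup.

(** * Running time *)

(** Deliberately coarse: even loops that follow each other are multiplied. Only one loop of the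
    program has an exponential bound, so the others merely raise the degree of the polynomial. *)
Fixpoint loop_product (eps : nat -> nat) (c : cmd) : nat :=
  match c with
  | CSeq c1 c2 | CIf _ c1 c2 => loop_product eps c1 * loop_product eps c2
  | CLoop _ b c => (eps b).+1 * loop_product eps c
  | _ => 1
  end.

Fixpoint weight (c : cmd) : nat :=
  match c with
  | CSeq c1 c2 => weight c1 + weight c2
  | CIf _ c1 c2 => 3 + weight c1 + weight c2
  | CLoop _ _ c => weight c + 8
  | _ => 5
  end.

Lemma loop_product_gt0 eps c : 0 < loop_product eps c.
Proof. by elim: c => //= *; rewrite muln_gt0; apply/andP. Qed.

Lemma time_le eps c : time eps c <= weight c * loop_product eps c.
Proof.
elim: c => //= [c1 IH1 c2 IH2|_ c1 IH1 c2 IH2|_ b c IH];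
  have := loop_product_gt0 eps.
- by move=> P; have := P c1; have := P c2; move: IH1 IH2; set x := loop_product _ _; nia.
- by move=> P; have := P c1; have := P c2; move: IH1 IH2; set x := loop_product _ _; nia.
- by move=> P; have := P c; move: IH; set x := loop_product _ _; nia.
Qed.

Lemma solver_time n k :
  time (loop_bound n k) solver <= weight solver * (8 * 3 ^ k * (n + k + 1) ^ 10).
Proof.
apply: leq_trans (time_le _ _) _; rewrite leq_mul2l; apply/orP; right.
set N := n + k + 1; set Q := 3 ^ k.
have [n1 k1] : n.+1 <= N /\ k.+1 <= N by rewrite /N; lia.
have q1 : 0 < Q by rewrite expn_gt0.
have [Q1 N4] : Q.+1 <= 2 * Q /\ (4 * n).+2 <= 4 * N by lia.
have N2 : (n * n).+1 <= N * N by nia.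
rewrite [loop_product _ _]/= /loop_bound /= -/Q !muln1 !mul1n.
(* The factors in program order: squaring, reading and power loops; seeds, words, reset, fuel; the
   two nested scanning loops and the advance loop. *)
have -> : 8 * Q * N ^ 10 =
  N * (N * N * N) * (N * (2 * Q * (N * (4 * N * (N * N * N))))).
  by rewrite !expnS expn0; lia.
by repeat (apply: leq_mul => //).
Qed.

(** Since [3 ^ k <= 2 ^ (2 * k)] and [n < 2 ^ n], the logarithm of every value in use is linear in
    [n + k]. *)
Lemma word_cost_le n k : word_cost (value_bound n k) <= 14 * (n + k + 1).
Proof.
rewrite /word_cost /bitlen; set x := 4 * _ + _.
suff: trunc_log 2 x < 2 * (n + k) + 7 by lia.
have x0 : 0 < x by rewrite /x; lia.
rewrite ltnNge; apply/negP=> le.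
have le1 : 2 ^ (2 * (n + k) + 7) <= x.
  by apply: leq_trans (trunc_logP (isT : 1 < 2) x0); rewrite leq_exp2l.
have := ltn_expl n (isT : 1 < 2); have := ltn_expl k (isT : 1 < 2).
have H3 : 3 ^ k <= 2 ^ k * 2 ^ k by rewrite -expnMn; case: (k) => // m; rewrite leq_exp2r.
have [p1 p2] : 0 < 2 ^ n /\ 0 < 2 ^ k by rewrite !expn_gt0.
have H1 := ltn_expl n (isT : 1 < 2); have H2 := ltn_expl k (isT : 1 < 2).
move: le1; rewrite /x /value_bound expnD mulnDr expnD !mul2n -!addnn !expnD (_ : 2 ^ 7 = 128) //.
set A := 2 ^ n in p1 H1 *; set C := 2 ^ k in p2 H2 H3 *; set Q := 3 ^ k in H3 *.
have : n * n <= A * A by apply: leq_mul; apply: ltnW.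
have : A * A <= A * A * (C * C) by rewrite leq_pmulr // muln_gt0 p2.
have : C * C <= A * A * (C * C) by rewrite leq_pmull // muln_gt0 p1.
have : A <= A * A by rewrite leq_pmulr.
have : C <= C * C by rewrite leq_pmulr.
lia.
Qed.

(* The base 3 leaves enough room below 4 to absorb any polynomial in n: if
   2^k is larger than a suitable power of n then 3^k n^d <= 4^k, and
   otherwise 3^k is itself polynomial in n. *)
Lemma additive_bound K d : exists (f : nat -> nat) (c : nat),
  bigO f (fun k => trunc_log 2 k ^ 2) /\
  forall n k, K * 3 ^ k * (n + k + 1) ^ d <= 4 ^ (k + f k) + n ^ c.
Proof.
(* [K] is absorbed by [K <= 2 ^ K], the other terms of [f] by bounding [(k + 1) ^ d] and a factor
   [2 ^ d]. The summands of [c] bound [K], [3 ^ k] and [(n + k + 1) ^ d] when [k] is logarithmic in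
   [n]. *)
pose f k := K + d + d * (trunc_log 2 k).+1.
pose c := K + 10 * d + (5 * d + 2) * d.
exists f, c; split.
  (* From [k = 2] on the logarithm is positive, so its square dominates the constants as well. *)
  exists (K + d + d + d), 2 => k le2; rewrite /f.
  have : 1 <= trunc_log 2 k by rewrite -(@trunc_expnK 2 1) //; apply: leq_trunc_log.
  set t := trunc_log 2 k => t1; rewrite -mulnn.
  have T1 : 1 <= t * t by rewrite muln_gt0 t1.
  have tT : t <= t * t by rewrite leq_pmulr.
  have := leq_mul (leqnn K) T1; have := leq_mul (leqnn d) T1; have := leq_mul (leqnn d) tT; lia.
have log_lt m : m.+1 <= 2 ^ (trunc_log 2 m).+1 by apply: trunc_log_ltn.
move=> n k; set l := trunc_log 2 n.
have pow34 m : 3 ^ m <= 4 ^ m by case: m => // m; rewrite leq_exp2r.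
have KE : K <= 2 ^ K by apply: ltnW; apply: ltn_expl.
case: (leqP (5 * d * l) k) => cmp.
  apply: leq_trans (leq_addr _ _).
  (* The 5 in the threshold works because [3 ^ 5 * 2 <= 4 ^ 5]: the gap over [5 * d * l] factors
     makes room for [2 ^ (d * l)]. *)
  have le3 : 3 ^ k * 2 ^ (d * l) <= 4 ^ k.
    rewrite -(subnKC cmp) !expnD mulnAC; apply: leq_mul; last exact: pow34.
    rewrite -mulnA [_ ^ (5 * _)]expnM [4 ^ (5 * _)]expnM -expnMn.
    by case: (d * l) => // m; rewrite leq_exp2r.
  (* The inequality [n + k + 1 <= (n + 1) * (k + 1)] separates the two variables. *)
  have leN : (n + k + 1) ^ d <= 2 ^ (d * l) * 2 ^ d * 2 ^ (d * (trunc_log 2 k).+1).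
    have -> : 2 ^ (d * l) * 2 ^ d * 2 ^ (d * (trunc_log 2 k).+1) =
              (2 ^ l.+1 * 2 ^ (trunc_log 2 k).+1) ^ d.
      by rewrite expnMn -!expnM ![_ * d]mulnC (mulnS d l) addnC expnD.
    case: (d) => // d'; rewrite leq_exp2r //.
    by apply: leq_trans (leq_mul (log_lt n) (log_lt k)); lia.
  apply: leq_trans (leq_mul (leq_mul KE (leqnn _)) leN) _.
  apply: (@leq_trans (4 ^ k * (2 ^ K * 2 ^ d * 2 ^ (d * (trunc_log 2 k).+1)))).
    apply: leq_trans (leq_mul le3 (leqnn _)).
    by move: (2 ^ K) (2 ^ d) (2 ^ (d * l)) (3 ^ k) (2 ^ (d * _)) => *; lia.
  rewrite expnD leq_mul2l -!expnD; apply/orP; right.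
  by rewrite -[4]/(2 ^ 2) -expnM leq_exp2l //; rewrite /f; lia.
apply: leq_trans (leq_addl _ _).
(* Here [k < 5 * d * l] forces [l] to be positive, so [n] is at least 2 and powers of [n] dominate
   powers of 2. *)
have n0 : 0 < n by rewrite lt0n; apply/eqP=> E; move: cmp; rewrite /l E trunc_log0 muln0.
have l0 : 0 < l by rewrite lt0n; apply/eqP=> E; move: cmp; rewrite E muln0.
have len : 2 ^ l <= n by apply: trunc_logP.
have n2 : 2 <= n by apply: leq_trans len; rewrite -{1}(expn1 2) leq_exp2l.
have pow2 m : 2 ^ m <= n ^ m by case: m => // m; rewrite leq_exp2r.
have le3 : 3 ^ k <= n ^ (10 * d).
  apply: (@leq_trans (2 ^ (l * (10 * d)))); last first.
    by rewrite expnM; case: (10 * d) => // m; rewrite leq_exp2r.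
  apply: leq_trans (pow34 k) _.
  by rewrite -[4]/(2 ^ 2) -expnM leq_exp2l //; lia.
have leN : (n + k + 1) ^ d <= n ^ ((5 * d + 2) * d).
  rewrite expnM; case Ed: (d) => [//|d']; rewrite leq_exp2r // -Ed.
  have ltl : l < n by apply: leq_trans (ltn_expl l (isT : 1 < 2)) len.
  apply: (@leq_trans ((5 * d).+1 * n)); first by nia.
  rewrite (_ : 5 * d + 2 = (5 * d).+1 + 1) ?addn2 ?addn1 // expnSr leq_mul2r; apply/orP; right.
  by apply: leq_trans (pow2 _); apply: ltnW; apply: ltn_expl.
rewrite /c (expnD n (K + 10 * d)) (expnD n K); apply: leq_mul => //; apply: leq_mul => //.
exact: leq_trans KE (pow2 K).
Qed.

(** * From graphs to numbered vertices *)

Lemma connected_transfer (T U : Type) (e : rel T) (e' : rel U) (W : pred T) (W' : pred U)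
    (f : T -> U) (g : U -> T) :
  (forall x, W x -> W' (f x)) -> (forall u, W' u -> W (g u)) ->
  (forall u, W' u -> f (g u) = u) ->
  (forall x y, W x -> W y -> e x y = e' (f x) (f y)) ->
  connected e W -> connected e' W'.
Proof.
move=> Wf Wg gK ef cW A clA u v Wu Wv; rewrite -(gK u) // -(gK v) //.
apply: (cW (fun x => A (f x))); rewrite ?Wg // => x y Wx Wy.
by rewrite ef //; apply: clA; apply: Wf.
Qed.

Lemma labelling_transfer (T U : Type) (D : pred T) (D' : pred U) (e : rel T) (e' : rel U)
    (f : T -> U) (g : U -> T) h m :
  (forall x, D x -> D' (f x)) -> (forall u, D' u -> D (g u)) ->
  (forall x, D x -> g (f x) = x) -> (forall u, D' u -> f (g u) = u) ->
  (forall x y, D x -> D y -> e x y = e' (f x) (f y)) ->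
  path_labelling D e h m -> path_labelling D' e' (fun u => h (g u)) m.
Proof.
move=> Df Dg fK gK ef [h1 h2 h3 h4 h5]; split.
- by move=> u /Dg /h1.
- by move=> j /h2 [x Dx <-]; exists (f x); rewrite ?fK ?Df.
- by move=> u v Du Dv e'uv; apply: h3; rewrite ?Dg // ef ?Dg // !gK.
- move=> j; apply: (connected_transfer (f := f) (g := g)) (h4 j).
  + by move=> x /andP [Dx hx]; rewrite /= Df // fK.
  + by move=> u /andP [Du hu]; rewrite /= Dg.
  + by move=> u /andP [Du _]; apply: gK.
  + by move=> x y /andP [Dx _] /andP [Dy _]; apply: ef.
- exact: (connected_transfer (f := f) (g := g)) h5.
Qed.

Section Encoding.
Variables (G : sgraph) (k : nat).

Definition matrix_seq : seq nat :=
  [seq nat_of_bool (edge x y) | x <- enum G, y <- enum G].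

(** The range tests confine the relation to vertices; an index beyond its row would alias an entry
    of a later row. *)
Definition matrix_rel w u := [&& w < #|G|, u < #|G| & 0 < nth 0 matrix_seq (w * #|G| + u)].

Lemma matrix_relE x0 w u : w < #|G| -> u < #|G| ->
  matrix_rel w u = edge (nth x0 (enum G) w) (nth x0 (enum G) u).
Proof.
move=> ltw ltu; rewrite /matrix_rel ltw ltu /= {1}cardE.
by rewrite (nth_allpairs _ x0 x0) -?cardE // lt0b.
Qed.

Lemma matrix_rel_lt w u : matrix_rel w u -> w < #|G| /\ u < #|G|.
Proof. by case/and3P. Qed.

Lemma matrix_rel_sym : symmetric matrix_rel.
Proof.
move=> w u; apply/idP/idP => /[dup] /matrix_rel_lt [ltw ltu];
  by rewrite !(matrix_relE (enum_val (Ordinal ltw))) // edge_sym.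
Qed.

Lemma solvable_path_contractible :
  solvable #|G| matrix_rel k <-> path_contractible G k.
Proof.
have idx_lt x : index x (enum G) < #|G| by rewrite cardE index_mem mem_enum.
have nthK x0 w : w < #|G| -> index (nth x0 (enum G) w) (enum G) = w.
  by move=> ltw; rewrite index_uniq ?enum_uniq // -cardE.
have relE x y : matrix_rel (index x (enum G)) (index y (enum G)) = edge x y.
  by rewrite (matrix_relE x) // !nth_index ?mem_enum.
split=> [[h [m [L le]]]|/path_contractibleP [h [m [L le]]]].
  apply/path_contractibleP.
  have [w ltw _] := label_surj L (leq0n m).
  pose x0 := enum_val (Ordinal ltw : 'I_#|G|).
  exists (fun x => h (index x (enum G))), m; split=> //.
  apply: (labelling_transfer (f := nth x0 (enum G))) L => //.
  - by move=> x _; apply: idx_lt.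
  - by move=> v ltv; apply: nthK.
  - by move=> x _; rewrite nth_index ?mem_enum.
  - by move=> v u ltv ltu; apply: matrix_relE.
have [x0 _ _] := label_surj L (leq0n m).
exists (fun w => h (nth x0 (enum G) w)), m; split=> //.
apply: (labelling_transfer (f := fun x => index x (enum G))) L => //.
- by move=> x _; apply: idx_lt.
- by move=> x _; rewrite nth_index ?mem_enum.
- by move=> v ltv; apply: nthK.
Qed.

End Encoding.

Theorem theorem4 :
  exists (P : program) (f : nat -> nat) (c : nat),
    bigO f (fun k => trunc_log 2 k ^ 2) /\
    forall (G : sgraph) (k : nat), exists (t : nat) (b : bool),
      [/\ answers P (encode G k) t b,
          b <-> path_contractible G k
        & t <= 4 ^ (k + f k) + #|G| ^ c].
Proof.
(* The factor 8 and the power 10 come from [solver_time], the factor 14 and one more power from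
   [word_cost_le]. *)
have [f [c [Of bound]]] := additive_bound (weight solver * 8 * 14) 11.
exists (compile 0 solver), f, c; split=> // G k.
set n := #|G|.
have size_l : size (matrix_seq G) = n * n by rewrite size_allpairs -cardE.
have le1 : all (fun v => v <= 1) (matrix_seq G).
  by apply/allP=> v /allpairsP [p [_ _ ->]]; apply: leq_b1.
have adj w u : w < n -> u < n -> (0 < nth 0 (matrix_seq G) (w * n + u)) = matrix_rel G w u.
  by move=> ltw ltu; rewrite /matrix_rel ltw ltu.
have [okc res] := solver_ok k size_l le1 adj.
have [t let_ ans] := compile_answers solver_wf okc.
exists t, (search_result n k (matrix_rel G)); split.
- by rewrite -res.
- rewrite -solvable_path_contractible -(acceptsP (@matrix_rel_lt G) (@matrix_rel_sym G)).
  split=> [/hasP [v]|[v [s [ltv lts acc]]]].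
    rewrite mem_iota => ltv /hasP [s]; rewrite mem_iota => lts acc.
    by exists v, s.
  by apply/hasP; exists v; rewrite ?mem_iota //; apply/hasP; exists s; rewrite ?mem_iota.
- apply: leq_trans let_ _; apply: leq_trans (bound n k).
  apply: leq_trans (leq_mul (solver_time n k) (word_cost_le n k)) _.
  by rewrite (expnSr _ 10); lia.
Qed.
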